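(* Let $d\in\mathbb{N}$. Then the Lipschitz-free space $\mathcal{F}(\mathbb{R}^d)$ has the Dunford--Pettis property.
   Context: $\mathbb{R}^d$ carries the Euclidean metric. Lipschitz-free space: given a metric space $M$ with a basepoint $0_M\in M$, $\mathrm{Lip}_0(M)$ denotes the Banach space of Lipschitz functions $f:M\to\mathbb{R}$ with $f(0_M)=0$, normed by the Lipschitz norm (the best Lipschitz constant). For $x\in M$, let $\delta_M(x)\in \mathrm{Lip}_0(M)^*$ be the evaluation $\delta_M(x)(f)=f(x)$. The Lipschitz-free space over $M$ is $\mathcal{F}(M)=\overline{\mathrm{span}}^{\|\cdot\|}\{\delta_M(x):x\in M\}\subset \mathrm{Lip}_0(M)^*$. Up to isometric isomorphism it does not depend on the choice of basepoint. Dunford--Pettis property: a Banach space $X$ has the Dunford--Pettis property if for every weakly null sequence $(x_n)_{n=1}^\infty$ in $X$ and every weakly null sequence $(f_n)_{n=1}^\infty$ in the dual $X^*$ (null for the weak topology $\sigma(X^*,X^{**})$), one has $f_n(x_n)\to 0$ as $n\to\infty$. *)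

(* Defs.v *)
From HB Require Import structures.
From mathcomp Require Import all_boot all_order all_algebra.
From mathcomp Require Import all_classical all_reals all_analysis.
From mathcomp Require Import ring lra.

Set Implicit Arguments.
Unset Strict Implicit.
Unset Printing Implicit Defensive.

Import Order.TTheory GRing.Theory Num.Theory.
Import numFieldNormedType.Exports.

Local Open Scope classical_set_scope.
Local Open Scope ring_scope.

(* The scalar field is written [R^o] when it is used as a normed space over
   itself. *)

Section Dual.
Context (R : realType) (X : normedModType R).

Definition dual_pred : {pred X -> R^o} :=
  [pred f : X -> R^o | `[< linear f /\ continuous f >] ].

Record dual := Dual { dual_fun :> X -> R^o ; dual_funP : dual_fun \in dual_pred }.

HB.instance Definition _ := [isSub for dual_fun].
HB.instance Definition _ := [Choice of dual by <:].

Fact dual_submod_closed : submod_closed dual_pred.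
Proof.
split.
  apply/asboolP; split; first by move=> a x y /=; rewrite scaler0 addr0.
  by move=> x; exact: cvg_cst.
move=> a f g /asboolP[lf cf] /asboolP[lg cg]; apply/asboolP; split.
  move=> b x y; rewrite !fctE lf lg.
  by rewrite !scalerDr !scalerA [a * b]mulrC -!addrA; congr (_ + _);
    rewrite addrCA.
move=> x; apply: cvgD; last exact: cg.
by apply: cvgZ; [exact: cvg_cst|exact: cf].
Qed.

HB.instance Definition _ :=
  GRing.isSubmodClosed.Build R (X -> R^o) dual_pred dual_submod_closed.
HB.instance Definition _ := [SubChoice_isSubLmodule of dual by <:].

Fact dual_is_linear (f : dual) : linear (f : X -> R^o).
Proof. by have /asboolP[] := dual_funP f. Qed.

HB.instance Definition _ (f : dual) :=
  GRing.isLinear.Build R X R^o *:%R (f : X -> R^o) (dual_is_linear f).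

Lemma dual_continuous (f : dual) : continuous (f : X -> R^o).
Proof. by have /asboolP[] := dual_funP f. Qed.

Lemma dualP (f g : dual) : (forall x, f x = g x) -> f = g.
Proof. by move=> fg; apply/val_inj/funext. Qed.

Definition dual_norm (f : dual) : R :=
  sup [set `|f x| | x in [set x : X | `|x| <= 1]].

Lemma dual_norm_has_sup (f : dual) :
  has_sup [set `|f x| | x in [set x : X | `|x| <= 1]].
Proof.
split; first by exists `|f 0|, 0 => //=; rewrite normr0.
have /linear_bounded_continuous/bounded_funP/(_ 1)[M fM] := @dual_continuous f.
by exists M => _ [x /= x1 <-]; exact: fM.
Qed.

Lemma dual_norm_bound (f : dual) (x : X) : `|f x| <= dual_norm f * `|x|.
Proof.
have [->|x0] := eqVneq x 0; first by rewrite linear0 !normr0 mulr0.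
rewrite -ler_pdivrMr ?normr_gt0//.
apply: ub_le_sup; first exact: (dual_norm_has_sup f).2.
exists (`|x|^-1 *: x) => /=.
  by rewrite normrZ normfV normr_id mulVf ?normr_eq0.
by rewrite linearZ /= normrZ normfV normr_id mulrC.
Qed.

Lemma dual_norm_le (f : dual) (k : R) :
  0 <= k -> (forall x, `|f x| <= k * `|x|) -> dual_norm f <= k.
Proof.
move=> k0 fk; apply: ge_sup; first exact: (dual_norm_has_sup f).1.
move=> _ [x /= x1 <-]; apply: le_trans (fk x) _.
by rewrite -[leRHS]mulr1 ler_wpM2l.
Qed.

Lemma dual_norm_ge0 (f : dual) : 0 <= dual_norm f.
Proof.
apply: le_trans (normr_ge0 (f 0)) _; apply: ub_le_sup.
  exact: (dual_norm_has_sup f).2.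
by exists 0 => //=; rewrite normr0.
Qed.

Fact ler_dual_normD (f g : dual) :
  dual_norm (f + g) <= dual_norm f + dual_norm g.
Proof.
apply: dual_norm_le => [|x]; first by rewrite addr_ge0 ?dual_norm_ge0.
rewrite mulrDl; apply: le_trans (ler_normD _ _) _.
by apply: lerD; exact: dual_norm_bound.
Qed.

Fact dual_normZ (a : R) (f : dual) : dual_norm (a *: f) = `|a| * dual_norm f.
Proof.
have le_normZ (b : R) (g : dual) : dual_norm (b *: g) <= `|b| * dual_norm g.
  apply: dual_norm_le => [|x]; first by rewrite mulr_ge0 ?dual_norm_ge0.
  by rewrite normrZ -mulrA ler_wpM2l// dual_norm_bound.
apply/eqP; rewrite eq_le le_normZ /=.
have [->|a0] := eqVneq a 0; first by rewrite normr0 mul0r dual_norm_ge0.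
rewrite mulrC -ler_pdivlMr ?normr_gt0//.
rewrite -{1}[f]scale1r -(mulVf a0) -scalerA.
by rewrite mulrC -normfV le_normZ.
Qed.

Fact dual_norm_eq0 (f : dual) : dual_norm f = 0 -> f = 0.
Proof.
move=> f0; apply: dualP => x; apply/eqP; rewrite -normr_le0.
by rewrite (le_trans (dual_norm_bound f x))// f0 mul0r.
Qed.

HB.instance Definition _ := Lmodule_isNormed.Build R dual
  ler_dual_normD dual_normZ dual_norm_eq0.

Lemma dual_normE (f : dual) :
  `|f| = sup [set `|f x| | x in [set x : X | `|x| <= 1]].
Proof. by []. Qed.

Fact dual_complete (F : set_system dual) :
  ProperFilter F -> cauchy F -> cvg F.
Proof.
move=> FF /cauchyP Fc.
have Fball (f : dual) (e : R) : F (ball f e) ->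
    forall x, F [set h : dual | `|f x - h x| <= e * `|x|].
  move=> Ff x; apply: filterS Ff => h; rewrite -ball_normE /= => /ltW fh.
  by rewrite (le_trans (dual_norm_bound (f - h) x))// ler_wpM2r.
have Fcx (x : X) : cvg ((fun f : dual => f x) @ F).
  apply: cauchy_cvg; apply/cauchy_exP => e e0.
  have d0 : 0 < e / (`|x| + 1) by rewrite divr_gt0// ltr_wpDl.
  have [f Ff] := Fc _ d0; exists (f x).
  move: (Fball _ _ Ff x); apply: (@filterS _ F) => h /= fh.
  rewrite -ball_normE /= (le_lt_trans fh)//.
  by rewrite mulrAC ltr_pdivrMr ?ltr_wpDl// ltr_pM2l// ltrDl.
pose g (x : X) : R^o := lim ((fun f : dual => f x) @ F).
have gball (f : dual) (e : R) : F (ball f e) ->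
    forall x, `|f x - g x| <= e * `|x|.
  move=> /Fball Ff x.
  apply: (cvgr_to_le (F := F) _ (Ff x)).
  by apply: cvg_norm; apply: cvgB; [exact: cvg_cst|exact: Fcx].
have lg : linear g.
  move=> a x y; apply: (@cvg_lim R^o) => //.
  have -> : (fun f : dual => f (a *: x + y)) = (fun f : dual => a *: f x + f y).
    by apply/funext => f; rewrite linearP.
  by apply: cvgD; [apply: cvgZ; [exact: cvg_cst|exact: Fcx]|exact: Fcx].
pose gL := HB.pack_for {linear X -> R^o} g (GRing.isLinear.Build R X R^o *:%R g lg).
have cg : continuous g.
  apply: (@bounded_linear_continuous _ _ _ gL); apply/bounded_funP => r.
  have [f /gball fg] := Fc _ ltr01.
  exists (dual_norm f * `|r| + `|r|) => x xr /=.
  have {}xr : `|x| <= `|r| by rewrite (le_trans xr) ?ler_norm.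
  rewrite (_ : g x = f x - (f x - g x)); last by rewrite opprB addrCA subrr addr0.
  rewrite (le_trans (ler_normB _ _))// lerD//.
    by rewrite (le_trans (dual_norm_bound _ _))// ler_wpM2l ?dual_norm_ge0.
  by rewrite (le_trans (fg x))// mul1r.
have gP : g \in dual_pred by apply/asboolP.
apply/cvg_ex; exists (Dual gP); apply/cvgrPdist_le => e e0.
have e20 : 0 < e / 2 by rewrite divr_gt0.
have [f Ff] := Fc _ e20; move: (Ff); apply: filterS => h.
rewrite -ball_normE /= => /ltW fh.
have -> : Dual gP - h = (f - h) - (f - Dual gP).
  by rewrite opprB [RHS]addrC addrA subrK.
rewrite (le_trans (ler_normB _ _))// [leRHS]splitr lerD//.
by apply: dual_norm_le => [|x]; [exact: ltW|exact: gball].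
Qed.

HB.instance Definition _ := Uniform_isComplete.Build dual dual_complete.
End Dual.

Section WeakTopology.
Context (R : realType) (X : normedModType R).

(* The coarsest topology on [X] making every [f : dual X] continuous. On
   [dual X] it is sigma(X', X''), not the weak-star topology. *)
Definition weak_topology : Type := sup_topology (fun f : dual X =>
  Topological.class (initial_topology (f : X -> R^o))).

HB.instance Definition _ := Topological.on weak_topology.

Definition weakly_null (x : nat -> X) : Prop :=
  x @ \oo --> ((0 : X) : weak_topology).

Lemma weakly_nullP (x : nat -> X) :
  weakly_null x <-> forall f : dual X, f (x n) @[n --> \oo] --> (0 : R^o).
Proof.
rewrite /weakly_null; split=> [/(cvg_sup _ _ _).1 xw f|xf].
  have := cvg_comp _ _ (xw f) (@initial_continuous _ _ (f : X -> R^o) 0).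
  by rewrite linear0.
apply/cvg_sup => f A.
rewrite (@nbhsE (initial_topology (f : X -> R^o))) => -[_ [[B oB <-] B0] BA].
apply: filterS BA _; apply: xf; apply: open_nbhs_nbhs; split=> //.
by move: B0; rewrite /= linear0.
Qed.
End WeakTopology.

Definition dunford_pettis (R : realType) (X : completeNormedModType R) : Prop :=
  forall (x : nat -> X) (f : nat -> dual X),
    weakly_null x -> weakly_null f -> f n (x n) @[n --> \oo] --> (0 : R^o).

Section Lip0.
Context (R : realType) (M : metricType R) (o : M).

(* The nonnegative Lipschitz constants of [f]. *)
Definition lipschitz_const (f : M -> R^o) : set R :=
  [set k | 0 <= k /\ forall x y, `|f x - f y| <= k * mdist x y].

Definition lip0_pred : {pred M -> R^o} :=
  [pred f : M -> R^o | `[< f o = 0 /\ lipschitz_const f !=set0 >] ].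

Record lip0 := Lip0 { lip0_fun :> M -> R^o ; lip0_funP : lip0_fun \in lip0_pred }.

HB.instance Definition _ := [isSub for lip0_fun].
HB.instance Definition _ := [Choice of lip0 by <:].

Fact lip0_submod_closed : submod_closed lip0_pred.
Proof.
split.
  apply/asboolP; split=> //; exists 0; split=> // x y.
  by rewrite subrr normr0 mul0r.
move=> a f g /asboolP[fo [k [k0 fk]]] /asboolP[go [l [l0 gl]]].
apply/asboolP; split; first by rewrite !fctE fo go scaler0 addr0.
exists (`|a| * k + l); split; first by rewrite addr_ge0 ?mulr_ge0.
move=> x y; rewrite !fctE opprD addrACA -scalerBr mulrDl.
rewrite (le_trans (ler_normD _ _))// lerD// normrZ -mulrA.
by rewrite ler_wpM2l.
Qed.

HB.instance Definition _ :=
  GRing.isSubmodClosed.Build R (M -> R^o) lip0_pred lip0_submod_closed.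
HB.instance Definition _ := [SubChoice_isSubLmodule of lip0 by <:].

Lemma lip0_base (f : lip0) : f o = 0.
Proof. by have /asboolP[] := lip0_funP f. Qed.

Definition lip_norm (f : lip0) : R := inf (lipschitz_const f).

Lemma lipschitz_const_has_inf (f : lip0) : has_inf (lipschitz_const f).
Proof.
by split; [have /asboolP[] := lip0_funP f|exists 0 => k []].
Qed.

Lemma lip_norm_ge0 (f : lip0) : 0 <= lip_norm f.
Proof.
by apply: lb_le_inf; [exact: (lipschitz_const_has_inf f).1|move=> k []].
Qed.

Lemma lip_norm_bound (f : lip0) (x y : M) :
  `|f x - f y| <= lip_norm f * mdist x y.
Proof.
have [->|xy] := eqVneq x y; first by rewrite subrr normr0 mdistxx mulr0.
have d0 : 0 < mdist x y by rewrite mdist_gt0.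
rewrite -ler_pdivrMr//; apply: lb_le_inf.
  exact: (lipschitz_const_has_inf f).1.
by move=> k [k0 fk]; rewrite ler_pdivrMr.
Qed.

Lemma lip_norm_le (f : lip0) (k : R) :
  0 <= k -> (forall x y, `|f x - f y| <= k * mdist x y) -> lip_norm f <= k.
Proof.
by move=> k0 fk; apply: ge_inf; [exact: (lipschitz_const_has_inf f).2|].
Qed.

Fact ler_lip_normD (f g : lip0) : lip_norm (f + g) <= lip_norm f + lip_norm g.
Proof.
apply: lip_norm_le => [|x y]; first by rewrite addr_ge0 ?lip_norm_ge0.
rewrite -[_ - _]/((f x + g x) - (f y + g y)) opprD addrACA mulrDl.
rewrite (le_trans (ler_normD _ _))// lerD//.
  exact: lip_norm_bound.
exact: lip_norm_bound.
Qed.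

Fact lip_normZ (a : R) (f : lip0) : lip_norm (a *: f) = `|a| * lip_norm f.
Proof.
have le_normZ (b : R) (g : lip0) : lip_norm (b *: g) <= `|b| * lip_norm g.
  apply: lip_norm_le => [|x y]; first by rewrite mulr_ge0 ?lip_norm_ge0.
  by rewrite -scalerBr normrZ -mulrA ler_wpM2l// lip_norm_bound.
apply/eqP; rewrite eq_le le_normZ /=.
have [->|a0] := eqVneq a 0; first by rewrite normr0 mul0r lip_norm_ge0.
rewrite mulrC -ler_pdivlMr ?normr_gt0//.
rewrite -{1}[f]scale1r -(mulVf a0) -scalerA.
by rewrite mulrC -normfV le_normZ.
Qed.

Fact lip_norm_eq0 (f : lip0) : lip_norm f = 0 -> f = 0.
Proof.
move=> f0; apply/val_inj/funext => x; apply/eqP; rewrite -normr_le0 /=.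
rewrite -[lip0_fun f x]subr0 -{1}(lip0_base f).
by rewrite (le_trans (lip_norm_bound f _ _))// f0 mul0r.
Qed.

HB.instance Definition _ := Lmodule_isNormed.Build R lip0
  ler_lip_normD lip_normZ lip_norm_eq0.

Lemma lip_normE (f : lip0) : `|f| = inf (lipschitz_const f).
Proof. by []. Qed.

Definition eval_at (x : M) (f : lip0) : R^o := f x.

Fact eval_at_linear (x : M) : linear (eval_at x).
Proof. by []. Qed.

HB.instance Definition _ (x : M) :=
  GRing.isLinear.Build R lip0 R^o *:%R (eval_at x) (eval_at_linear x).

Fact eval_at_dual (x : M) : eval_at x \in @dual_pred R lip0.
Proof.
apply/asboolP; split; first exact: eval_at_linear.
apply: bounded_linear_continuous; apply/bounded_funP => r.
exists (`|r| * mdist x o) => f fr.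
rewrite -[X in `|X|]/(lip0_fun f x) -[lip0_fun f x]subr0 -{1}(lip0_base f).
rewrite (le_trans (lip_norm_bound f _ _))//.
by rewrite ler_wpM2r ?mdist_ge0// (le_trans fr) ?ler_norm.
Qed.

Definition delta (x : M) : dual lip0 := Dual (eval_at_dual x).

End Lip0.

Section ClosedSpan.
Context (R : realType) (V : normedModType R).

Definition lin_span (A : set V) : set V :=
  [set v | exists (n : nat) (c : 'I_n -> R) (a : 'I_n -> V),
    (forall i, A (a i)) /\ v = \sum_(i < n) c i *: a i].

Lemma lin_span0 (A : set V) : lin_span A 0.
Proof.
exists 0, (fun=> 0), (fun=> 0); split; last by rewrite big_ord0.
by case.
Qed.

Lemma lin_spanP (A : set V) (k : R) (u v : V) :
  lin_span A u -> lin_span A v -> lin_span A (k *: u + v).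
Proof.
move=> [n [c [a [Aa ->]]]] [m [d [b [Ab ->]]]].
exists (n + m)%N,
  (fun i => match fintype.split i with inl j => k * c j | inr j => d j end),
  (fun i => match fintype.split i with inl j => a j | inr j => b j end); split.
  by move=> i; case: (fintype.split i).
rewrite big_split_ord /= scaler_sumr; congr (_ + _).
  apply: eq_bigr => i _.
  by rewrite (unsplitK (inl i : 'I_n + 'I_m)) scalerA.
by apply: eq_bigr => i _; rewrite (unsplitK (inr i : 'I_n + 'I_m)).
Qed.

Lemma closure_lin_span0 (A : set V) : closure (lin_span A) 0.
Proof. exact/subset_closure/lin_span0. Qed.

Lemma closure_lin_spanP (A : set V) (k : R) (u v : V) :
  closure (lin_span A) u -> closure (lin_span A) v ->
  closure (lin_span A) (k *: u + v).
Proof.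
move=> cu cv B kuvB.
have : (fun z : V * V => k *: z.1 + z.2) @ (u, v) --> k *: u + v.
  apply: cvgD; last exact: cvg_snd.
  by apply: cvgZ; [exact: cvg_cst|exact: cvg_fst].
move=> /(_ _ kuvB)[[P Q] /= [Pu Qv] PQB].
have [p [Ap Pp]] := cu _ Pu; have [q [Aq Qq]] := cv _ Qv.
exists (k *: p + q); split; first exact: lin_spanP.
exact: (PQB (p, q)).
Qed.

End ClosedSpan.

Section LipschitzFree.
Context (R : realType) (M : metricType R) (o : M).

(* The closure is taken in the operator norm of [dual (lip0 o)]. *)
Definition lipfree_pred : {pred dual (lip0 o)} :=
  [pred m | `[< closure (lin_span (range (@delta R M o))) m >] ].

Record lipfree := LipFree {
  lipfree_val :> dual (lip0 o) ; lipfree_valP : lipfree_val \in lipfree_pred }.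

HB.instance Definition _ := [isSub for lipfree_val].
HB.instance Definition _ := [Choice of lipfree by <:].

Fact lipfree_submod_closed : submod_closed lipfree_pred.
Proof.
split; first by apply/asboolP; exact: closure_lin_span0.
move=> a u v /asboolP cu /asboolP cv; apply/asboolP.
exact: closure_lin_spanP.
Qed.

HB.instance Definition _ :=
  GRing.isSubmodClosed.Build R (dual (lip0 o)) lipfree_pred lipfree_submod_closed.
HB.instance Definition _ := [SubChoice_isSubLmodule of lipfree by <:].

Definition lipfree_norm (m : lipfree) : R := `|lipfree_val m|.

Fact ler_lipfree_normD (m n : lipfree) :
  lipfree_norm (m + n) <= lipfree_norm m + lipfree_norm n.
Proof. exact: ler_normD. Qed.

Fact lipfree_normZ (a : R) (m : lipfree) :
  lipfree_norm (a *: m) = `|a| * lipfree_norm m.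
Proof. exact: normrZ. Qed.

Fact lipfree_norm_eq0 (m : lipfree) : lipfree_norm m = 0 -> m = 0.
Proof. by move=> /normr0_eq0 m0; exact: val_inj. Qed.

HB.instance Definition _ := Lmodule_isNormed.Build R lipfree
  ler_lipfree_normD lipfree_normZ lipfree_norm_eq0.

Lemma lipfree_normE (m : lipfree) : `|m| = `|lipfree_val m|.
Proof. by []. Qed.

Fact lipfree_complete (F : set_system lipfree) :
  ProperFilter F -> cauchy F -> cvg F.
Proof.
move=> FF /cauchyP Fc.
pose G : set_system (dual (lip0 o)) := lipfree_val @ F.
have /cvg_ex[/= l Gl] : cvg G.
  apply: cauchy_cvg; apply/cauchy_exP => e e0.
  have [m Fm] := Fc _ e0; exists (lipfree_val m).
  move: Fm; apply: (@filterS _ F) => n.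
  by rewrite -!ball_normE.
have lP : l \in lipfree_pred.
  apply/asboolP; apply: (closed_cvg _ (@closed_closure _ _) _ _ Gl).
  by apply: nearW => m; have /asboolP := lipfree_valP m.
apply/cvg_ex; exists (LipFree lP); apply/cvgrPdist_lt => e e0.
by have /cvgrPdist_lt/(_ e e0) := Gl.
Qed.

HB.instance Definition _ := Uniform_isComplete.Build lipfree lipfree_complete.

End LipschitzFree.

Section Euclidean.
Context (R : realType) (d : nat).

(* An alias: ['rV[R]_d] itself carries the sup norm. *)
Definition euclidean : Type := 'rV[R]_d.

HB.instance Definition _ := Choice.on euclidean.

Definition euclidean_dist (x y : euclidean) : R :=
  Num.sqrt (\sum_(i < d) (x 0 i - y 0 i) ^+ 2).

Fact euclidean_distxx (x : euclidean) : euclidean_dist x x = 0.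
Proof.
by rewrite /euclidean_dist big1 ?sqrtr0// => i _; rewrite subrr expr0n.
Qed.

Fact euclidean_dist_eq0 (x y : euclidean) : euclidean_dist x y = 0 -> x = y.
Proof.
move/eqP; rewrite sqrtr_eq0 => s0; apply/rowP => i; apply/eqP.
rewrite -subr_eq0 -sqrf_eq0 eq_le sqr_ge0 andbT; apply: le_trans s0.
by rewrite (bigD1 i)//= lerDl sumr_ge0// => j _; exact: sqr_ge0.
Qed.

Fact euclidean_dist_sym (x y : euclidean) :
  euclidean_dist x y = euclidean_dist y x.
Proof.
by congr Num.sqrt; apply: eq_bigr => i _; rewrite -sqrrN opprB.
Qed.

Lemma cauchy_schwarz_sum (a b : 'I_d -> R) :
  (\sum_i a i * b i) ^+ 2 <= (\sum_i a i ^+ 2) * (\sum_i b i ^+ 2).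
Proof.
set A := \sum_i a i ^+ 2; set B := \sum_i b i ^+ 2; set C := \sum_i a i * b i.
have B0 : 0 <= B by apply: sumr_ge0 => i _; exact: sqr_ge0.
have quad (t s : R) : 0 <= t ^+ 2 * A + 2 * t * s * C + s ^+ 2 * B.
  have -> : t ^+ 2 * A + 2 * t * s * C + s ^+ 2 * B =
      \sum_i (t * a i + s * b i) ^+ 2.
    rewrite !mulr_sumr -!big_split /=; apply: eq_bigr => i _; ring.
  by apply: sumr_ge0 => i _; exact: sqr_ge0.
have [B_eq0|Bn0] := eqVneq B 0.
  have b0 i : b i = 0.
    apply/eqP; rewrite -sqrf_eq0 eq_le sqr_ge0 andbT -B_eq0 /B (bigD1 i)//=.
    by rewrite lerDl sumr_ge0// => j _; exact: sqr_ge0.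
  by rewrite B_eq0 mulr0 /C big1 ?expr0n// => i _; rewrite b0 mulr0.
have Bp : 0 < B by rewrite lt_neqAle eq_sym Bn0.
have := quad B (- C).
have -> : B ^+ 2 * A + 2 * B * - C * C + (- C) ^+ 2 * B = B * (A * B - C ^+ 2).
  by ring.
by rewrite pmulr_rge0// subr_ge0.
Qed.

Fact euclidean_dist_triangle (y x z : euclidean) :
  euclidean_dist x z <= euclidean_dist x y + euclidean_dist y z.
Proof.
pose a i := x 0 i - y 0 i; pose b i := y 0 i - z 0 i.
have sq0 (u : 'I_d -> R) : 0 <= \sum_i u i ^+ 2.
  by apply: sumr_ge0 => i _; exact: sqr_ge0.
rewrite -(@ler_pXn2r _ 2) ?nnegrE ?addr_ge0 ?sqrtr_ge0//.
rewrite sqrrD !sqr_sqrtr ?sq0//.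
have -> : \sum_(i < d) (x 0 i - z 0 i) ^+ 2 =
    \sum_i a i ^+ 2 + 2 * (\sum_i a i * b i) + \sum_i b i ^+ 2.
  by rewrite mulr_sumr -!big_split /=; apply: eq_bigr => i _; rewrite /a /b; ring.
rewrite lerD2r lerD2l -[leRHS]mulr_natl ler_pM2l//.
rewrite -sqrtrM ?sq0// (le_trans (ler_norm _))// -sqrtr_sqr ler_wsqrtr//.
exact: cauchy_schwarz_sum.
Qed.

HB.instance Definition _ := isMetric.Build R euclidean euclidean_distxx
  euclidean_dist_eq0 euclidean_dist_sym euclidean_dist_triangle.

Lemma euclidean_mdistE (x y : euclidean) :
  mdist x y = Num.sqrt (\sum_(i < d) (x 0 i - y 0 i) ^+ 2).
Proof. by []. Qed.

End Euclidean.

(* Main.v *)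
Require Import Defs.
From HB Require Import structures.
From mathcomp Require Import all_boot all_order all_algebra.
From mathcomp Require Import all_classical all_reals all_analysis.
From mathcomp Require Import ring lra.

(* Suppose f_n(x_n) >= delta along an ultrafilter U.  A function g in Lip_0 is
   identified with its difference quotients on M x M, so by Hahn-Banach every
   x_n is induced by a positive functional nu_n on bounded functions on M x M.
   Weak nullity of (f_n) forces nu(|diff_quot f_n|) -> 0 for every positive
   functional nu, in particular for limits of the nu_k.  Interpolating f_n on a
   fine grid makes it smooth enough for its local slope to be dominated by a
   Lipschitz function a_n, itself controlled by averages of |diff_quot f_n|.
   Following Bourgain's treatment of rich subspaces of C(K), one extracts a
   subsequence and sets u_n = phi_n f_n with phi_{n+1} = phi_n (1 - a_n): the
   local slope of u_n is about phi_n a_n, so the slopes telescope and all partial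
   sums of the u_n are uniformly Lipschitz, while x_n(u_n) stays close to
   f_n(x_n) because nu_n(a_j) is tiny for j < n.  A limit of the partial sums is
   then a functional that does not tend to 0 along (x_n). *)

Set Implicit Arguments.
Unset Strict Implicit.
Unset Printing Implicit Defensive.

Import Order.TTheory GRing.Theory Num.Theory.
Import numFieldNormedType.Exports.

Local Open Scope classical_set_scope.
Local Open Scope ring_scope.

(** * Positive functionals on bounded functions *)

Section PositiveFunctionals.
Context {R : realType}.

(** Two obstacles shape the proof. The quotients [diff_quot f_n] live on pairs of points, whereas a
    cutoff [phi] must be a Lipschitz function of one point for multiplication by it to preserve
    Lip_0; hence the grid, with averages over nodes in place of a gradient. Moreover the mesh [m]
    can only be chosen after [f_n], while smallness must hold for [nu_k] with later [k]. So [nu_k]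
    of a slope at mesh [m] is bounded by [nu_k] of a pattern, which is a positive functional of
    [|diff_quot f_n|] that does not itself depend on [f_n]. Its limit along [U] in [k], then in [m],
    is a single positive functional fixed in advance; an [n] that is good for it is good for many
    [m], and then for many [k]. This limit exists because the masses of the patterns are bounded
    uniformly in [m], by a constant depending on [d]. Positive functionals are only finitely
    additive, so bounded convergence needs its own argument, by ultrafilters on pairs of points.
    Since R^d is unbounded, each [phi] equals 1 far from the base point, so that only the smallness
    of [f_n] on a ball matters. *)

Definition bdd (S : Type) (h : S -> R) : Prop := exists M, forall s, `|h s| <= M.

(** A finitely additive measure of finite mass [nu (fun=> 1)], given by its integral. The laws are
    imposed on bounded functions only, so [nu] can be a total function with arbitrary values
    elsewhere. *)
Definition posfun (S : Type) (nu : (S -> R) -> R) : Prop :=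
  (forall a h k, bdd h -> bdd k ->
     nu (fun s => a * h s + k s) = a * nu h + nu k) /\
  (forall h, bdd h -> (forall s, 0 <= h s) -> 0 <= nu h).

Lemma bdd_cst (S : Type) (c : R) : bdd (fun _ : S => c).
Proof. by exists `|c|. Qed.

Lemma bddD (S : Type) (h k : S -> R) :
  bdd h -> bdd k -> bdd (fun s => h s + k s).
Proof.
move=> [M hM] [N kN]; exists (M + N) => s.
by rewrite (le_trans (ler_normD _ _))// lerD.
Qed.

Lemma bddM (S : Type) (h k : S -> R) :
  bdd h -> bdd k -> bdd (fun s => h s * k s).
Proof. by move=> [M hM] [N kN]; exists (M * N) => s; rewrite normrM ler_pM. Qed.

Lemma bddN (S : Type) (h : S -> R) : bdd h -> bdd (fun s => - h s).
Proof. by move=> [M hM]; exists M => s; rewrite normrN. Qed.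

Lemma bddB (S : Type) (h k : S -> R) :
  bdd h -> bdd k -> bdd (fun s => h s - k s).
Proof. by move=> bh bk; apply: bddD => //; exact: bddN. Qed.

Lemma bdd_norm (S : Type) (h : S -> R) : bdd h -> bdd (fun s => `|h s|).
Proof. by move=> [M hM]; exists M => s; rewrite normr_id. Qed.

Lemma bdd_comp (S T : Type) (g : T -> S) (h : S -> R) :
  bdd h -> bdd (fun t => h (g t)).
Proof. by move=> [M hM]; exists M => t. Qed.

Lemma bdd_sum (S : Type) (I : finType) (h : I -> S -> R) :
  (forall i, bdd (h i)) -> bdd (fun s => \sum_i h i s).
Proof.
move=> /choice[M hM]; exists (\sum_i M i) => s.
by rewrite (le_trans (ler_norm_sum _ _ _))// ler_sum.
Qed.

Lemma bdd_itv (S : Type) (h : S -> R) (M : R) :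
  (forall s, 0 <= h s <= M) -> bdd h.
Proof. by move=> hM; exists M => s; have /andP[h0 hs] := hM s; rewrite ger0_norm. Qed.

Section Theory.
Context (S : Type) (nu : (S -> R) -> R) (nuP : posfun nu).

Lemma posfunD (h k : S -> R) : bdd h -> bdd k ->
  nu (fun s => h s + k s) = nu h + nu k.
Proof.
move=> bh bk; rewrite -[nu h]mul1r -(nuP.1 1)//; congr (nu _).
by apply/funext => s; rewrite mul1r.
Qed.

Lemma posfun0 : nu (fun=> 0) = 0.
Proof.
have := posfunD (bdd_cst S 0) (bdd_cst S 0).
under eq_fun do rewrite addr0.
by move/eqP; rewrite -subr_eq subrr eq_sym => /eqP.
Qed.

Lemma posfunZ (a : R) (h : S -> R) : bdd h -> nu (fun s => a * h s) = a * nu h.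
Proof.
move=> bh; rewrite -[RHS]addr0 -posfun0 -nuP.1 //; last exact: bdd_cst.
by congr (nu _); apply/funext => s; rewrite addr0.
Qed.

Lemma posfunB (h k : S -> R) : bdd h -> bdd k ->
  nu (fun s => h s - k s) = nu h - nu k.
Proof.
move=> bh bk; rewrite addrC -[- nu k]mulN1r -nuP.1 //.
by congr (nu _); apply/funext => s; rewrite mulN1r addrC.
Qed.

Lemma le_posfun (h k : S -> R) : bdd h -> bdd k ->
  (forall s, h s <= k s) -> nu h <= nu k.
Proof.
move=> bh bk hk; rewrite -subr_ge0 -posfunB //; apply: nuP.2; first exact: bddB.
by move=> s; rewrite subr_ge0.
Qed.

Lemma posfun_cst (c : R) : nu (fun=> c) = c * nu (fun=> 1).
Proof.
rewrite -posfunZ; last exact: bdd_cst.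
by congr (nu _); apply/funext => s; rewrite mulr1.
Qed.

Lemma posfun_le_cst (h : S -> R) (M : R) :
  bdd h -> (forall s, h s <= M) -> nu h <= M * nu (fun=> 1).
Proof. by move=> bh hM; rewrite -posfun_cst; apply: le_posfun => //; exact: bdd_cst. Qed.

Lemma posfun1_ge0 : 0 <= nu (fun=> 1).
Proof. by apply: nuP.2 => //; exact: bdd_cst. Qed.

Lemma posfun_norm_le (h : S -> R) (M : R) :
  (forall s, `|h s| <= M) -> `|nu h| <= M * nu (fun=> 1).
Proof.
move=> hM; have bh : bdd h by exists M.
rewrite ler_norml; apply/andP; split.
  rewrite -mulNr -posfun_cst; apply: le_posfun => //; first exact: bdd_cst.
  by move=> s; have := hM s; rewrite ler_norml => /andP[].
by apply: posfun_le_cst => // s; exact: le_trans (ler_norm _) (hM s).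
Qed.

End Theory.

(** * Limits of bounded functions along an ultrafilter *)

Section UltraLimit.
Context (T : Type) (U : set_system T) {UU : UltraFilter U}.

Definition ulim (a : T -> R) : R := lim ((a : T -> R^o) @ U).

(** Compactness of [-M, M] yields a cluster point, and an ultrafilter converges to each of its
    cluster points. *)
Lemma ulim_cvg (a : T -> R) : bdd a -> (a : T -> R^o) @ U --> (ulim a : R^o).
Proof.
move=> [M aM].
have FF : ProperFilter ((a : T -> R^o) @ U) by exact: fmap_proper_filter.
have aU : ((a : T -> R^o) @ U) `[- M, M]%classic.
  by apply: nearW => t /=; rewrite in_itv /= -ler_norml.
have [p [_ clp]] := @segment_compact R (- M) M _ FF aU.
have : (a : T -> R^o) @ U --> (p : R^o).
  apply/cvgrPdist_lt => e e0.
  have [//|nU] := in_ultra_setVsetC [set t | `|p - a t| < e] UU.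
  have pe : nbhs (p : R^o) (ball (p : R^o) e) by exact: nbhsx_ballx.
  have aU' : ((a : T -> R^o) @ U) [set y | ~ `|p - y| < e] by exact: nU.
  have [y [ny]] := clp _ _ aU' pe.
  by rewrite -ball_normE /= => /ny.
by move/cvgP.
Qed.

Lemma ulim_unique (a : T -> R) (l : R) : (a : T -> R^o) @ U --> (l : R^o) ->
  ulim a = l.
Proof. by move=> al; apply: cvg_lim. Qed.

Lemma ulim_le (a : T -> R) (l : R) :
  bdd a -> U [set t | a t <= l] -> ulim a <= l.
Proof. by move=> /ulim_cvg al; apply: (cvgr_to_le (F := U) al). Qed.

Lemma ulim_ge (a : T -> R) (l : R) :
  bdd a -> U [set t | l <= a t] -> l <= ulim a.
Proof. by move=> /ulim_cvg al; apply: (cvgr_to_ge (F := U) al). Qed.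

Lemma ulim_lt (a : T -> R) (l : R) :
  bdd a -> ulim a < l -> U [set t | a t < l].
Proof. by move=> /ulim_cvg al; apply: (cvgr_lt _ al). Qed.

Lemma ulim_gt (a : T -> R) (l : R) :
  bdd a -> l < ulim a -> U [set t | l < a t].
Proof. by move=> /ulim_cvg al; apply: (cvgr_gt _ al). Qed.

Lemma ulim_posfun : posfun ulim.
Proof.
split=> [a h k bh bk|h bh h0]; last by apply: ulim_ge => //; exact: nearW.
apply: ulim_unique; apply: (@cvgD _ R^o); last exact: ulim_cvg.
by apply: (@cvgM R); [exact: cvg_cst|exact: ulim_cvg].
Qed.

Lemma ulim1 : ulim (fun=> 1) = 1.
Proof. by apply: ulim_unique; exact: cvg_cst. Qed.

End UltraLimit.
End PositiveFunctionals.

(** * The Hahn-Banach theorem *)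

Section HahnBanach.
Context {R : realType} (V : lmodType R) (D : set V) (p : V -> R).
Hypothesis D_lin : forall a u v, D u -> D v -> D (a *: u + v).
Hypothesis p_add : forall u v, D u -> D v -> p (u + v) <= p u + p v.
Hypothesis p_homo : forall a u, D u -> 0 < a -> p (a *: u) = a * p u.

(** A partial linear functional below [p], encoded by its graph. Single-valuedness is not imposed:
    it follows from linearity and domination, because [p 0 = 0]. *)
Definition dominated_graph (G : set (V * R)) : Prop :=
  (forall a u v, G u -> G v -> G (a *: u.1 + v.1, a * u.2 + v.2)) /\
  (forall u, G u -> D u.1 /\ u.2 <= p u.1).

(** A value [c] at [w] is admissible when it lies between all [u.2 - p (u.1 - w)] and all
    [p (v.1 + w) - v.2]. Subadditivity of [p] puts the first family below the second, so the
    supremum of the first serves; homogeneity reduces general multiples of [w] to these two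
    cases. *)
Lemma dominated_graph_extend (G : set (V * R)) (w : V) :
  G !=set0 -> dominated_graph G -> D w ->
  exists2 G', dominated_graph G' & G `<=` G' /\ exists r, G' (w, r).
Proof.
move=> [u0 Gu0] [Glin Gdom] Dw.
have Gscale a u : G u -> G (a *: u.1, a * u.2).
  move=> Gu; have := Glin (a - 1) u u Gu Gu.
  by rewrite !scalerBl !mulrBl scale1r mul1r !subrK.
have DB u : D u -> D (u - w).
  by move=> Du; rewrite addrC -scaleN1r; exact: D_lin.
have DD u : D u -> D (u + w) by move=> Du; rewrite -[u]scale1r; exact: D_lin.
pose E := [set u.2 - p (u.1 - w) | u in G].
have E_ub v : G v -> ubound E (p (v.1 + w) - v.2).
  move=> Gv _ [u Gu <-]; rewrite lerBrDr addrAC lerBlDr.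
  have [_] := Gdom _ (Glin 1 u v Gu Gv); rewrite /= scale1r mul1r.
  move=> /le_trans; apply.
  have -> : u.1 + v.1 = (v.1 + w) + (u.1 - w) by rewrite [RHS]addrACA subrr addr0 addrC.
  by apply: p_add; [apply: DD; have [] := Gdom _ Gv|apply: DB; have [] := Gdom _ Gu].
have E0 : E !=set0 by exists (u0.2 - p (u0.1 - w)), u0.
have E_sup : has_sup E by split=> //; exists (p (u0.1 + w) - u0.2); exact: E_ub.
pose c := sup E.
have c_le v : G v -> c <= p (v.1 + w) - v.2 by move=> Gv; apply: ge_sup => //; exact: E_ub.
have c_ge u : G u -> u.2 - p (u.1 - w) <= c.
  by move=> Gu; apply: ub_le_sup; [exact: E_sup.2|exists u].
exists [set z | exists u t, G u /\ z = (u.1 + t *: w, u.2 + t * c)]; last first.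
  split=> [u Gu|]; first by exists u, 0; rewrite scale0r mul0r !addr0 -surjective_pairing.
  exists c, (0 *: u0.1, 0 * u0.2), 1; split; first exact: Gscale.
  by rewrite /= scale0r mul0r !add0r scale1r mul1r.
split=> [a _ _ [u [t [Gu ->]]] [v [s [Gv ->]]]|_ [u [t [Gu ->]]]] /=.
  exists (a *: u.1 + v.1, a * u.2 + v.2), (a * t + s); split; first exact: Glin.
  congr pair => /=; first by rewrite scalerDr addrACA scalerA -scalerDl.
  by ring.
have [Du pu] := Gdom _ Gu.
split; first by rewrite addrC; exact: D_lin.
have [t0|t0|->] := ltgtP t 0; last by rewrite scale0r mul0r !addr0.
- have s0 : 0 < - t by rewrite oppr_gt0.
  have := c_ge _ (Gscale (- t)^-1 _ Gu); rewrite /= => h.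
  have := ler_wpM2l (ltW s0) h; rewrite mulrBr mulrA divff ?gt_eqF// mul1r.
  rewrite -p_homo//; last by have [Dv _] := Gdom _ (Gscale (- t)^-1 _ Gu); exact: DB.
  rewrite scalerBr scalerA divff ?gt_eqF// scale1r scaleNr opprK mulNr.
  by move=> h'; lra.
- have := c_le _ (Gscale t^-1 _ Gu); rewrite /= => h.
  have := ler_wpM2l (ltW t0) h; rewrite mulrBr mulrA divff ?gt_eqF// mul1r.
  rewrite -p_homo//; last by have [Dv _] := Gdom _ (Gscale t^-1 _ Gu); exact: DD.
  by rewrite scalerDr scalerA divff ?gt_eqF// scale1r => h'; lra.
Qed.

Theorem hahn_banach (G0 : set (V * R)) : G0 !=set0 -> dominated_graph G0 ->
  exists F : V -> R,
    [/\ forall a u v, D u -> D v -> F (a *: u + v) = a * F u + F v,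
        forall v, D v -> F v <= p v &
        forall u, G0 u -> F u.1 = u.2].
Proof.
move=> [z0 G0z0] G0dom.
pose P := [set A : set (V * R) | A = set0 \/ (G0 `<=` A /\ dominated_graph A)].
have [A [PA Amax]] : exists A, P A /\ forall B, A `<` B -> ~ P B.
  apply: Zorn_bigcup => F FP Ftot; rewrite /P /=.
  have [[X [FX Xn0]]|allE] := pselect (exists X, F X /\ X <> set0); last first.
    left; rewrite -subset0 => u [X FX Xu]; case: allE; exists X; split=> // X0.
    by move: Xu; rewrite X0.
  right; split; first by have [//|[G0X _]] := FP _ FX; move=> u G0u; exists X => //; exact: G0X.
  have domF Y u : F Y -> Y u -> dominated_graph Y.
    by move=> FY Yu; have [Y0|[]//] := FP _ FY; move: Yu; rewrite Y0.
  split=> [a u v [Y FY Yu] [Z FZ Zv]|u [Y FY Yu]].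
    have [YZ|ZY] := Ftot _ _ FY FZ.
      by exists Z => //; have [Zlin _] := domF _ _ FZ Zv; apply: Zlin => //; exact: YZ.
    by exists Y => //; have [Ylin _] := domF _ _ FY Yu; apply: Ylin => //; exact: ZY.
  by have [_ Ydom] := domF _ _ FY Yu; exact: Ydom.
have [G0A Adom] : G0 `<=` A /\ dominated_graph A.
  case: PA => // A0; case: (Amax G0); last by right; split.
  by rewrite A0; split=> [u []|sub]; have := sub _ G0z0.
have Atotal v : D v -> exists r, A (v, r).
  move=> Dv; apply: contrapT => nAv.
  have [|B Bdom [AB [r Bv]]] := @dominated_graph_extend A v _ Adom Dv.
    by exists z0; exact: G0A.
  case: (Amax B); first by split=> // BA; apply: nAv; exists r; exact: BA.
  by right; split=> //; exact: subset_trans AB.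
have p0 u : D u -> p 0 = 0.
  move=> Du; have D0 : D 0 by have := D_lin (-1) Du Du; rewrite scaleN1r addNr.
  by have := p_homo D0 (ltr0n _ 2); rewrite scaler0; lra.
have Auniq v r s : A (v, r) -> A (v, s) -> r = s.
  have le r' s' : A (v, r') -> A (v, s') -> s' <= r'.
    move=> Ar As; have [] := Adom.2 _ (Adom.1 (-1) _ _ Ar As).
    rewrite /= scaleN1r addNr (p0 v) ?mulN1r; last by have [] := Adom.2 _ Ar.
    by move=> _; rewrite addrC subr_le0.
  by move=> Ar As; apply/eqP; rewrite eq_le !le.
have /choice[F FA] : forall v, exists r, D v -> A (v, r).
  move=> v; have [/Atotal[r Ar]|nD] := pselect (D v); first by exists r.
  by exists 0.
exists F; split=> [a u v Du Dv|v Dv|[v r] G0v].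
- apply: Auniq; first by apply: FA; exact: D_lin.
  exact: (Adom.1 a _ _ (FA _ Du) (FA _ Dv)).
- exact: (Adom.2 _ (FA _ Dv)).2.
- have Av := G0A _ G0v; apply: Auniq (Av); apply: FA.
  by have [] := Adom.2 _ Av.
Qed.

End HahnBanach.

(** * Bounded convergence for finitely additive integrals *)

Lemma ultra_frequently (J : set nat) :
  (forall N, exists2 n, (N <= n)%N & J n) ->
  exists U : set_system nat, [/\ UltraFilter U, \oo `<=` U & U J].
Proof.
move=> infJ.
have PF : ProperFilter (within J \oo).
  apply: Build_ProperFilter_ex => A [N _ NA].
  by have [n Nn Jn] := infJ N; exists n; exact: NA.
have [U [UU FU]] := ultraFilterLemma PF.
exists U; split=> //.
  by move=> A oA; apply: FU; rewrite /within /=; apply: filterS oA.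
by apply: FU; rewrite /within /=; exact: nearW.
Qed.

Section BoundedConvergence.
Context {R : realType} (S : Type) (nu : (S -> R) -> R) (nuP : posfun nu).

Let mu (B : set S) : R := nu \1_B.

Let bdd_indic (B : set S) : bdd (\1_B : S -> R).
Proof. by apply: (@bdd_itv _ _ _ 1) => s; rewrite indicE; case: (_ \in _); rewrite lexx ler01. Qed.

Let mu_le (B C : set S) : B `<=` C -> mu B <= mu C.
Proof.
move=> BC; apply: le_posfun => // s; rewrite !indicE.
have [/set_mem Bs|_] := boolP (s \in B); last by case: (_ \in _).
by rewrite mem_set //; exact: BC.
Qed.

Let muU (B C : set S) : mu (B `|` C) = mu B + mu C - mu (B `&` C).
Proof.
rewrite /mu -posfunD // -posfunB //; last exact: bddD.
congr (nu _); apply/funext => s; rewrite !indicE in_setU in_setI.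
by case: (s \in B); case: (s \in C); rewrite /= ?addr0 ?subr0 ?add0r ?addrK.
Qed.

Let mu_ge0 (B : set S) : 0 <= mu B.
Proof. exact: nuP.2. Qed.

Let mu_leT (B : set S) : mu B <= nu (fun=> 1).
Proof.
rewrite -[leRHS]mul1r; exact: posfun_le_cst.
Qed.

Let mu_bdd T (B : T -> set S) : bdd (fun t => mu (B t)).
Proof. by exists (nu (fun=> 1)) => t; rewrite ger0_norm. Qed.

(* Otherwise the sets [B `&` A i] would be pairwise almost disjoint, yet all of
   measure bounded below. *)
Let ultra_meet (U : set_system nat) {UU : UltraFilter U} (A : nat -> set S)
    (B : set S) :
  0 < ulim U (fun j => mu (B `&` A j)) ->
  U [set i | 0 < ulim U (fun j => mu (B `&` A i `&` A j))].
Proof.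
move=> eB; set e := ulim _ _ in eB.
have [//|nU] := in_ultra_setVsetC
  [set i | 0 < ulim U (fun j => mu (B `&` A i `&` A j))] UU.
exfalso.
(* [D] collects [k] pieces of the form [B] meet [A i]. A new piece has measure above 3e/4 and
   overlaps [D] in less than e/4, so each round gains e/2, which eventually exceeds the total
   mass. *)
have step k : exists D, ulim U (fun j => mu (D `&` A j)) <= 0 /\
    k%:R * (e / 2) <= mu D.
  elim: k => [|k [D [eD muD]]].
    exists set0; rewrite mul0r; split=> //.
    apply: ulim_le => //; apply: nearW => j; rewrite /= set0I /mu.
    have -> : \1_(set0 : set S) = (fun=> 0 : R) by apply/funext => s; rewrite indicE in_set0.
    by rewrite posfun0.
  have e4 : 0 < e / 4 by lra.
  have U1 : U [set j | 3 * (e / 4) < mu (B `&` A j)].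
    by apply: ulim_gt => //; rewrite -/e; lra.
  have U2 : U [set j | mu (D `&` A j) < e / 4].
    by apply: ulim_lt => //; exact: le_lt_trans eD _.
  have [i [[/= ni Bi] Di]] := filter_ex (filterI (filterI nU U1) U2).
  exists (D `|` (B `&` A i)); split.
    have eBi : ulim U (fun j => mu (B `&` A i `&` A j)) <= 0.
      by rewrite leNgt; apply/negP.
    apply: (@le_trans _ _ (ulim U (fun j => mu (D `&` A j) + mu (B `&` A i `&` A j)))).
      apply: (le_posfun (ulim_posfun (U := U))) => //; first exact: bddD.
      by move=> j; rewrite setIUl muU gerBl.
    by rewrite (posfunD (ulim_posfun (U := U))) //; lra.
  have : mu (D `&` (B `&` A i)) <= mu (D `&` A i).
    by apply: mu_le => s [Ds [_ As]].
  by rewrite muU -natr1; lra.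
have [D [_]] := step (Num.bound (nu (fun=> 1) / (e / 2))).
have := mu_leT D => h1 h2.
have /andP[_] : 0 <= (nu (fun=> 1) / (e / 2)) < (Num.bound (nu (fun=> 1) / (e / 2)))%:R.
  by rewrite archi_boundP !divr_ge0 ?posfun1_ge0// ltW.
by rewrite ltr_pdivrMr; lra.
Qed.

(** Sets of measure bounded below have a subsequence with nonempty finite intersections. The
    invariant [0 < eta B] for the current intersection [B] keeps it nonempty and, by [ultra_meet],
    lets a later [A i] be intersected with it; [W] is any ultrafilter containing all these
    intersections. *)
Lemma ultra_frequently_meet (U : set_system nat) {UU : UltraFilter U}
    (A : nat -> set S) (c : R) :
  \oo `<=` U -> 0 < c -> U [set j | c <= nu \1_(A j)] ->
  exists W : set_system S, UltraFilter W /\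
    forall N, exists2 n, (N <= n)%N & W (A n).
Proof.
move=> ooU c0 Uc.
pose eta B := ulim U (fun j => mu (B `&` A j)).
have etaT : 0 < eta setT.
  apply: lt_le_trans c0 _; apply: ulim_ge => //.
  by apply: filterS Uc => j /=; rewrite setTI.
pose state := {Bj : set S * nat | 0 < eta Bj.1}.
pose next (s t : state) := (sval t).1 = (sval s).1 `&` A (sval t).2 /\
  ((sval s).2 < (sval t).2)%N.
have next_ex s : {t | next s t}.
  apply: cid; case: s => -[B j] /= eB.
  have Uj : U [set i | (j < i)%N] by apply: ooU; exact: nbhs_infty_gt.
  have [i [/= eBi ji]] := filter_ex (filterI (ultra_meet eB) Uj).
  by exists (exist _ (B `&` A i, i) eBi).
have [s [_ sn]] := dependent_choice next_ex (exist _ (setT, 0%N) etaT).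
pose B k := (sval (s k)).1; pose j k := (sval (s k)).2.
have Bdec k l : (k <= l)%N -> B l `<=` B k.
  elim: l => [|l IH]; first by rewrite leqn0 => /eqP ->.
  rewrite leq_eqVlt => /predU1P[->//|/IH Bkl].
  by rewrite {1}/B (sn l).1 => x [/Bkl].
have B0 k : B k !=set0.
  apply/set0P/eqP => Bk0; have /= := proj2_sig (s k).
  rewrite /eta -/(B k) Bk0 ltNge => /negP; apply.
  apply: ulim_le => //; apply: nearW => i; rewrite /= set0I /mu.
  have -> : \1_(set0 : set S) = (fun=> 0 : R) by apply/funext => x; rewrite indicE in_set0.
  by rewrite posfun0.
pose F : set_system S := [set C | exists k, B k `<=` C].
have FF : ProperFilter F.
  apply: Build_ProperFilter_ex.
    by move=> C [k BC]; have [x Bx] := B0 k; exists x; exact: BC.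
  split; first by exists 0%N.
    move=> P Q [k kP] [l lQ]; exists (maxn k l) => x Bx; split.
      by apply: kP; apply: Bdec Bx; exact: leq_maxl.
    by apply: lQ; apply: Bdec Bx; exact: leq_maxr.
  by move=> P Q PQ [k kP]; exists k; exact: subset_trans PQ.
have [W [WU FW]] := ultraFilterLemma FF.
exists W; split=> // N; exists (j N.+1).
  apply: ltnW; elim: N => [|N IH]; first by apply: leq_ltn_trans (sn 0%N).2.
  by apply: leq_ltn_trans (sn N.+1).2.
apply: FW; exists N.+1; rewrite /B (sn N).1.
exact: subIsetr.
Qed.

(* Bounded convergence for the finitely additive [nu]: pointwise convergence on
   the Stone-Cech compactification replaces pointwise convergence. *)
Lemma posfun_norm_cvg0 (h : nat -> S -> R) (M : R) :
  (forall n s, `|h n s| <= M) ->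
  (forall W : set_system S, UltraFilter W ->
    (fun n => ulim W (h n)) @ \oo --> (0 : R^o)) ->
  (fun n => nu (fun s => `|h n s|)) @ \oo --> (0 : R^o).
Proof.
move=> hM hW; apply: contrapT => ncv.
have hbdd n : bdd (h n) by exists M.
have M1 : 0 < `|M| + 1 by rewrite ltr_wpDl.
have [e e0 infe] : exists2 e, 0 < e & forall N, exists2 n, (N <= n)%N &
    e <= nu (fun s => `|h n s|).
  apply: contrapT => nE; apply: ncv; apply/cvgrPdist_lt => e e0.
  apply: contrapT => nN; apply: nE; exists e => // N.
  apply: contrapT => nn; apply: nN; exists N => // n /= Nn.
  rewrite sub0r normrN ger0_norm.
    by rewrite ltNge; apply/negP => en; apply: nn; exists n.
  by apply: nuP.2 => //; exact: bdd_norm.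
have [U [UU ooU Ue]] := ultra_frequently infe.
set m := nu (fun=> 1).
have m0 : 0 <= m by exact: posfun1_ge0.
(* Chebyshev: the part of [h n] below [t] contributes at most e/2, so the set where [|h n|] is at
   least [t] carries the other half. Along a common ultrafilter of infinitely many such sets, the
   limits of [h n] stay at least [t] in absolute value. *)
pose t := e / (2 * (m + 1)).
have t0 : 0 < t by rewrite divr_gt0// mulr_gt0// ltr_wpDl.
have tm : t * m <= e / 2.
  rewrite /t invfM mulrA -mulrA ler_piMr//; first by lra.
  by rewrite mulrC ler_pdivrMr ?ltr_wpDl// mul1r lerDl.
pose A n := [set s | t <= `|h n s|].
have [||W [WU Winf]] := @ultra_frequently_meet U UU A (e / (2 * (`|M| + 1))) ooU.
- by rewrite divr_gt0// mulr_gt0.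
- apply: filterS Ue => n /= en.
  have : nu (fun s => `|h n s|) <= nu (fun s => (`|M| + 1) * \1_(A n) s + t).
    apply: le_posfun => //; first exact: bdd_norm.
      by apply: bddD; [apply: bddM => //; exact: bdd_cst|exact: bdd_cst].
    move=> s; rewrite indicE; have [sA|/negP sA] := boolP (s \in A n).
      rewrite mulr1 (le_trans (hM n s))// (le_trans (ler_norm M))//.
      by have := t0; lra.
    rewrite mulr0 add0r ltW// ltNge; apply/negP => ts; apply: sA.
    by rewrite inE.
  rewrite (posfunD nuP) ?(posfun_cst nuP t) ?(posfunZ nuP (`|M| + 1)) -/m //.
  - move=> h1; rewrite ler_pdivrMr ?mulr_gt0//.
    have := le_trans en h1; rewrite -[nu (fun s => _)]/(mu (A n)) -/(mu (A n)).
    move: (mu _) => y h2; have -> : y * (2 * (`|M| + 1)) = 2 * ((`|M| + 1) * y) by ring.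
    by lra.
  - by apply: bddM => //; exact: bdd_cst.
  - exact: bdd_cst.
have /cvgrPdist_lt /(_ _ t0)[N _ Nt] := hW W WU.
have [n Nn WA] := Winf N.
have := Nt n Nn; rewrite /= sub0r normrN ltNge => /negP; apply.
have cv : (fun s => `|h n s|) @ W --> (`|ulim W (h n)| : R^o).
  by apply: (@cvg_norm _ R^o); exact: ulim_cvg.
by rewrite -(ulim_unique cv); apply: ulim_ge => //; exact: bdd_norm.
Qed.

End BoundedConvergence.

(** * Lipschitz-free spaces and their duals *)

Lemma dual_of_bound {R : realType} (X : normedModType R) (phi : X -> R^o) (k : R) :
  0 <= k -> linear phi -> (forall x, `|phi x| <= k * `|x|) ->
  exists2 F : dual X, (forall x, F x = phi x) & `|F| <= k.
Proof.
move=> k0 lphi bphi.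
pose phiL := HB.pack_for {linear X -> R^o} phi (GRing.isLinear.Build R X R^o *:%R phi lphi).
have cphi : continuous phi.
  apply: (@bounded_linear_continuous _ _ _ phiL); apply/bounded_funP => r.
  exists (k * `|r|) => x xr; rewrite (le_trans (bphi x))// ler_wpM2l//.
  exact: le_trans xr (ler_norm _).
have phiP : phi \in @dual_pred R X by apply/asboolP.
by exists (Dual phiP) => //; exact: dual_norm_le.
Qed.

Lemma dual_pointwise_bounded {R : realType} (X : completeNormedModType R)
    (f : nat -> dual X) :
  (forall x, bdd (fun n => f n x : R)) ->
  exists2 B, 0 <= B & forall n, `|f n| <= B.
Proof.
move=> fb.
have [|x|M HM] := @Banach_Steinhauss R X R^o
    [set (f n : X -> R^o) | n in setT] _ _ 1.
- move=> _ [n _ <-]; split; last exact: dual_is_linear.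
  move=> r; exists (`|f n| * `|r|) => x xr.
  rewrite (le_trans (dual_norm_bound _ _))// ler_wpM2l ?dual_norm_ge0//.
  exact: le_trans xr (ler_norm _).
- by have [M fM] := fb x; exists M => _ [n _ <-].
exists (Num.max 0 M); first by rewrite le_max lexx.
move=> n; apply: ge_sup; first exact: (dual_norm_has_sup (f n)).1.
move=> _ [x /= x1 <-]; rewrite le_max; apply/orP; right.
by apply: HM => //; exists n.
Qed.

Section DualOfLipschitzFree.
Context {R : realType} (M : metricType R) (o : M).

Lemma lip0_of_bound (g : M -> R) (k : R) : g o = 0 -> 0 <= k ->
  (forall p q, `|g p - g q| <= k * mdist p q) ->
  exists2 G : lip0 o, (forall p, G p = g p) & `|G| <= k.
Proof.
move=> g0 k0 gk.
have gP : (g : M -> R^o) \in lip0_pred o by apply/asboolP; split=> //; exists k.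
by exists (Lip0 gP) => //; exact: lip_norm_le.
Qed.

Lemma lipfree_approx (x : lipfree o) (e : R) : 0 < e ->
  exists (n : nat) (c : 'I_n -> R) (p : 'I_n -> M),
    `|lipfree_val x - \sum_i c i *: delta o (p i)| < e.
Proof.
move=> e0; have /asboolP clx := lipfree_valP x.
have [y [[n [c [a [Aa ->]]]] xy]] := clx _ (nbhsx_ballx (lipfree_val x) e e0).
have /choice[p pa] : forall i, exists p, delta o p = a i.
  by move=> i; have [p _ <-] := Aa i; exists p.
exists n, c, p; under eq_bigr do rewrite pa.
by move: xy; rewrite -ball_normE.
Qed.

Lemma delta_lipfree (p : M) : delta o p \in @lipfree_pred R M o.
Proof.
apply/asboolP; apply: subset_closure; exists 1%N, (fun=> 1), (fun=> delta o p).
by split; [move=> i; exists p|rewrite big_ord1 scale1r].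
Qed.

Definition free_delta (p : M) : lipfree o := LipFree (delta_lipfree p).

Lemma dual_sumE (X : normedModType R) (n : nat) (c : 'I_n -> R) (f : 'I_n -> dual X) x :
  (\sum_i c i *: f i) x = \sum_i c i * f i x.
Proof. by elim/big_ind2 : _ => // ? ? ? ? <- <-. Qed.

Lemma free_delta_dist (p q : M) : `|free_delta p - free_delta q| <= mdist p q.
Proof.
rewrite lipfree_normE; apply: dual_norm_le; first exact: mdist_ge0.
by move=> g; rewrite mulrC; exact: lip_norm_bound.
Qed.

(** One half of the identification of the dual of the free space with Lip_0: [G] is forced on
    evaluations, and both sides of the last identity are norm continuous in [x] and agree on the
    span of the evaluations. *)
Lemma lip_of_dual (f : dual (lipfree o)) : exists G : lip0 o,
  [/\ forall p, G p = f (free_delta p), `|G| <= `|f| &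
      forall x, f x = lipfree_val x G].
Proof.
have f0 : f (free_delta o) = 0.
  have -> : free_delta o = 0; last exact: linear0.
  by apply/val_inj/dualP => g /=; exact: lip0_base.
have [|p q|G GE Gn] := @lip0_of_bound (fun p => f (free_delta p)) `|f| f0.
- exact: dual_norm_ge0.
- rewrite -linearB; apply: le_trans (dual_norm_bound _ _) _.
  by rewrite ler_wpM2l ?dual_norm_ge0 ?free_delta_dist.
exists G; split=> // x; apply/eqP; rewrite -subr_eq0 -normr_le0.
apply/ler_addgt0Pl => e e0; rewrite addr0.
have K0 : 0 < 2 * (`|f| + 1) by rewrite mulr_gt0// ltr_wpDl.
have [n [c [p xp]]] := lipfree_approx x (divr_gt0 e0 K0).
pose y : lipfree o := \sum_i c i *: free_delta (p i).
have yE : lipfree_val y = \sum_i c i *: delta o (p i).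
  by rewrite /y; elim/big_ind2 : _ => // ? ? ? ? <- <-.
have fy : f y = lipfree_val y G.
  rewrite yE dual_sumE linear_sum; apply: eq_bigr => i _.
  by rewrite linearZ /= -GE.
have -> : f x - lipfree_val x G = f (x - y) - (lipfree_val x - lipfree_val y) G.
  have -> : f (x - y) = f x - f y by exact: linearB.
  rewrite -[(lipfree_val x - lipfree_val y) G]/(lipfree_val x G - lipfree_val y G).
  by rewrite -fy opprB addrA subrK.
apply: le_trans (ler_normB _ _) _.
have xy : `|lipfree_val x - lipfree_val y| <= e / (2 * (`|f| + 1)) by rewrite yE ltW.
have h1 : `|f (x - y)| <= `|f| * (e / (2 * (`|f| + 1))).
  apply: le_trans (dual_norm_bound _ _) _; rewrite ler_wpM2l ?dual_norm_ge0//.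
have h2 : `|(lipfree_val x - lipfree_val y) G| <= `|f| * (e / (2 * (`|f| + 1))).
  apply: le_trans (dual_norm_bound _ _) _; rewrite mulrC.
  by apply: ler_pM => //; exact: dual_norm_ge0.
apply: le_trans (lerD h1 h2) _.
rewrite -mulr2n -mulrnAr -mulr_natl.
have -> : 2 * (e / (2 * (`|f| + 1))) = e / (`|f| + 1).
  by field; rewrite gt_eqF// ltr_wpDl.
by rewrite mulrCA ger_pMr// ler_pdivrMr ?mul1r ?lerDl ?ltr_wpDl.
Qed.

(** On bounded subsets of Lip_0, pointwise convergence is weak-star convergence: [x] is a norm limit
    of finite combinations of evaluations, and the bound [B] makes the approximation error uniform
    in [t]. *)
Lemma lipfree_cvg_pointwise (T : Type) (F : set_system T) {FF : Filter F}
    (x : lipfree o) (g : T -> lip0 o) (G : lip0 o) (B : R) :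
  (forall t, `|g t| <= B) -> `|G| <= B ->
  (forall p, (fun t => g t p) @ F --> G p) ->
  (fun t => lipfree_val x (g t)) @ F --> lipfree_val x G.
Proof.
move=> gB GB gG; apply/cvgrPdist_lt => e e0.
have B0 : 0 <= B by apply: le_trans GB; exact: lip_norm_ge0.
have K0 : 0 < 4 * (B + 1) by rewrite mulr_gt0// ltr_wpDl.
have [n [c [p xp]]] := lipfree_approx x (divr_gt0 e0 K0).
set y := \sum_i _ in xp.
have ycv : (fun t => y (g t)) @ F --> y G.
  rewrite /y dual_sumE; under eq_fun do rewrite dual_sumE.
  apply: (@cvg_big R^o) => [|i _]; first exact: add_continuous.
  by apply: (@cvgM R); [exact: cvg_cst|exact: gG].
have e2 : 0 < e / 2 by lra.
move/cvgrPdist_lt : ycv => /(_ _ e2); apply: filterS => t yt.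
have small (h : lip0 o) : `|h| <= B -> `|lipfree_val x h - y h| <= e / 4.
  move=> hB; rewrite -[_ - _]/((lipfree_val x - y) h).
  apply: le_trans (dual_norm_bound _ _) _.
  apply: (@le_trans _ _ (e / (4 * (B + 1)) * B)).
    by apply: ler_pM => //; [exact: dual_norm_ge0|exact: ltW].
  rewrite invfM mulrA -mulrA ler_piMr//; first by rewrite divr_ge0// ltW.
  by rewrite mulrC ler_pdivrMr ?ltr_wpDl// mul1r lerDl.
have -> : lipfree_val x G - lipfree_val x (g t) =
  (lipfree_val x G - y G) + (y G - y (g t)) - (lipfree_val x (g t) - y (g t)) by ring.
have h1 := small _ GB; have h2 := small _ (gB t).
have h3 := ler_normB (lipfree_val x G - y G + (y G - y (g t))) (lipfree_val x (g t) - y (g t)).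
have h4 := ler_normD (lipfree_val x G - y G) (y G - y (g t)).
by lra.
Qed.

(* Equal to [0] on the diagonal, since [0 / 0 = 0]. *)
Definition diff_quot (g : M -> R) (s : M * M) : R := (g s.1 - g s.2) / mdist s.1 s.2.

Lemma diff_quotE (g : M -> R) (p q : M) :
  g p - g q = diff_quot g (p, q) * mdist p q.
Proof.
rewrite /diff_quot /=; have [->|pq] := eqVneq p q; first by rewrite !subrr !mul0r.
by rewrite divfK// gt_eqF// mdist_gt0.
Qed.

Lemma diff_quot_le (g : M -> R) (k : R) (s : M * M) : 0 <= k ->
  `|g s.1 - g s.2| <= k * mdist s.1 s.2 -> `|diff_quot g s| <= k.
Proof.
move=> k0; rewrite /diff_quot normrM normfV (ger0_norm (mdist_ge0 _ _)) => h.
have [->|pq] := eqVneq s.1 s.2; first by rewrite mdistxx invr0 mulr0.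
by rewrite ler_pdivrMr// mdist_gt0.
Qed.

Lemma diff_quot_lip0 (g : lip0 o) (s : M * M) : `|diff_quot g s| <= `|g|.
Proof. by apply: diff_quot_le; [exact: lip_norm_ge0|exact: lip_norm_bound]. Qed.

Lemma bdd_diff_quot_lip0 (g : lip0 o) : bdd (diff_quot g).
Proof. by exists `|g|; exact: diff_quot_lip0. Qed.

(* The functional [h |-> `|x| * sup h] dominates [x] without absolute values
   since [diff_quot g] is antisymmetric; this makes the extension positive. *)
Lemma dual_lip0_posfun (x : dual (lip0 o)) : exists nu : (M * M -> R) -> R,
  [/\ posfun nu, nu (fun=> 1) <= `|x| & forall g : lip0 o, x g = nu (diff_quot g)].
Proof.
pose D : set (M * M -> R^o) := [set h | bdd (h : M * M -> R)].
pose p (h : M * M -> R^o) : R := `|x| * sup (range (h : M * M -> R)).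
have hs (h : M * M -> R^o) : D h -> has_sup (range (h : M * M -> R)).
  move=> [B hB]; split; first by exists (h (o, o)), (o, o).
  by exists B => _ [s _ <-]; exact: le_trans (ler_norm _) (hB s).
have le_sup (h : M * M -> R^o) s : D h -> h s <= sup (range (h : M * M -> R)).
  by move=> Dh; apply: ub_le_sup; [exact: (hs _ Dh).2|exists s].
have ge_sup' (h : M * M -> R^o) (c : R) : D h -> (forall s, h s <= c) ->
    sup (range (h : M * M -> R)) <= c.
  by move=> Dh hc; apply: ge_sup; [exact: (hs _ Dh).1|move=> _ [s _ <-]].
have D_lin a (u v : M * M -> R^o) : D u -> D v -> D (a *: u + v).
  by move=> Du Dv; apply: bddD => //; apply: (@bddM _ _ (fun=> a)) => //; exact: bdd_cst.
have p_add (u v : M * M -> R^o) : D u -> D v -> p (u + v) <= p u + p v.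
  move=> Du Dv; rewrite /p -mulrDr ler_wpM2l ?dual_norm_ge0//.
  apply: ge_sup'; first exact: bddD.
  by move=> s; apply: lerD; exact: le_sup.
have p_homo_le a (u : M * M -> R^o) : D u -> 0 < a ->
    sup (range (a *: u : M * M -> R)) <= a * sup (range (u : M * M -> R)).
  move=> Du a0; apply: ge_sup'; first by apply: (@bddM _ _ (fun=> a)) => //; exact: bdd_cst.
  by move=> s; rewrite -[(a *: u) s]/(a * u s) ler_pM2l// le_sup.
have p_homo a (u : M * M -> R^o) : D u -> 0 < a -> p (a *: u) = a * p u.
  move=> Du a0; rewrite /p mulrCA; congr (_ * _); apply/eqP.
  rewrite eq_le p_homo_le//= -ler_pdivlMl//.
  have Dau : D (a *: u) by apply: (@bddM _ _ (fun=> a)) => //; exact: bdd_cst.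
  have := p_homo_le a^-1 _ Dau; rewrite invr_gt0 => /(_ a0).
  by rewrite scalerA mulVf ?scale1r// gt_eqF.
pose G0 : set ((M * M -> R^o) * R) := [set (diff_quot g, x g) | g in [set: lip0 o]].
have [||F [Flin Fdom FG0]] := @hahn_banach R _ D p D_lin p_add p_homo G0.
- by exists (diff_quot (0 : lip0 o), x 0), 0.
- split=> [a _ _ [g _ <-] [h _ <-]|_ [g _ <-]] /=.
    exists (a *: g + h) => //; congr pair; last by rewrite linearP.
    apply/funext => s; rewrite -[RHS]/(a * diff_quot g s + diff_quot h s) /diff_quot.
    rewrite -[(a *: g + h) s.1]/(a * g s.1 + h s.1) -[(a *: g + h) s.2]/(a * g s.2 + h s.2).
    by ring.
  split; first exact: bdd_diff_quot_lip0.
  apply: le_trans (ler_norm _) _; apply: le_trans (dual_norm_bound _ _) _.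
  rewrite ler_wpM2l ?dual_norm_ge0//.
  have Dg := bdd_diff_quot_lip0 g.
  have leg u v : g u - g v <= sup (range (diff_quot g)) * mdist u v.
    by rewrite diff_quotE ler_wpM2r ?mdist_ge0// le_sup.
  apply: lip_norm_le => [|u v].
    by have := @le_sup _ (o, o) Dg; rewrite /diff_quot /= subrr mul0r.
  rewrite ler_norml leg andbT lerNl opprB.
  by have := leg v u; rewrite metric_sym.
exists F; split.
- split=> [a h k bh bk|h bh h0]; first exact: (Flin a h k).
  (* Positivity comes from domination: [h >= 0] gives [sup (- h) <= 0], hence [F (- h) <= 0]. *)
  have DNh : D (- h) by exact: bddN.
  have := Fdom _ DNh; have := Flin (-1) h 0 bh (bdd_cst _ 0).
  have := Flin (-1) 0 0 (bdd_cst _ 0) (bdd_cst _ 0).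
  rewrite !scaleN1r !addr0 => F0 ->.
  have -> : F 0 = 0 by move: F0; rewrite oppr0; lra.
  move=> hN; rewrite -oppr_le0 -mulN1r -[X in X <= _]addr0; apply: le_trans hN _.
  rewrite mulr_ge0_le0 ?dual_norm_ge0//; apply: ge_sup' => // s.
  by rewrite -[(- h) s]/(- h s) oppr_le0.
- apply: le_trans (Fdom _ (bdd_cst _ 1)) _.
  rewrite -[leRHS]mulr1 ler_wpM2l ?dual_norm_ge0//.
  by apply: ge_sup' => //; exact: bdd_cst.
- by move=> g; apply/esym; apply: (FG0 (_, _)); exists g.
Qed.

End DualOfLipschitzFree.

Lemma cvg_bdd {R : realType} (a : nat -> R) (l : R) :
  (a : nat -> R^o) @ \oo --> (l : R^o) -> bdd a.
Proof.
move=> al; have /cvg_seq_bounded/pinfty_ex_gt0[M M0 aM] : cvg ((a : nat -> R^o) @ \oo).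
  by apply/cvg_ex; exists l.
by exists M => n; exact: aM.
Qed.

(** * Consequences of weak nullity *)

Section WeaklyNull.
Context {R : realType} (M : metricType R) (o : M).

Lemma eval_bidual (X : normedModType R) (x : X) :
  exists2 E : dual (dual X), (forall f, E f = f x) & `|E| <= `|x|.
Proof.
apply: (@dual_of_bound _ _ (fun f : dual X => f x)) => // f.
by rewrite mulrC; exact: dual_norm_bound.
Qed.

Lemma weakly_null_eval (X : normedModType R) (f : nat -> dual X) (x : X) :
  weakly_null f -> (fun n => f n x) @ \oo --> (0 : R^o).
Proof.
move=> /weakly_nullP f0; have [E Ef _] := eval_bidual x.
by under eq_fun do rewrite -Ef; exact: f0.
Qed.

Lemma weakly_null_dual_bounded (X : completeNormedModType R) (f : nat -> dual X) :
  weakly_null f -> exists2 B, 0 <= B & forall n, `|f n| <= B.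
Proof.
move=> f0; apply: dual_pointwise_bounded => x.
by apply: cvg_bdd; exact: weakly_null_eval.
Qed.

(** Uniform boundedness for the [x n] viewed as functionals on [dual X], which is complete even if
    [X] is not. Only their action on [dual X] is bounded here; for the free space this recovers the
    norm, since that norm is a supremum over Lip_0. *)
Lemma weakly_null_bidual_bounded (X : normedModType R) (x : nat -> X) :
  weakly_null x ->
  exists2 B, 0 <= B & forall n (f : dual X), `|f (x n)| <= B * `|f|.
Proof.
move=> /weakly_nullP x0.
have /choice[E Ex] : forall n, exists E : dual (dual X), forall f, E f = f (x n).
  by move=> n; have [E Ex _] := eval_bidual (x n); exists E.
have [|B B0 EB] := @dual_pointwise_bounded _ (dual X) E.
  by move=> f; under eq_fun do rewrite Ex; apply: cvg_bdd; exact: x0.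
exists B => // n f; rewrite -Ex (le_trans (dual_norm_bound _ _))//.
by rewrite ler_wpM2r ?dual_norm_ge0//; exact: EB.
Qed.

Lemma dual_of_lip (g : lip0 o) : exists2 f : dual (lipfree o),
  (forall x, f x = lipfree_val x g) & `|f| <= `|g|.
Proof.
apply: (@dual_of_bound _ _ (fun x : lipfree o => lipfree_val x g)) => [|//|x].
  exact: lip_norm_ge0.
by rewrite mulrC lipfree_normE; exact: dual_norm_bound.
Qed.

Lemma weakly_null_lipfree (x : nat -> lipfree o) (g : lip0 o) :
  weakly_null x -> (fun n => lipfree_val (x n) g) @ \oo --> (0 : R^o).
Proof.
move=> /weakly_nullP x0; have [f fg _] := dual_of_lip g.
by under eq_fun do rewrite -fg; exact: x0.
Qed.

Lemma weakly_null_lipfree_bounded (x : nat -> lipfree o) :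
  weakly_null x -> exists2 B, 0 <= B & forall n, `|x n| <= B.
Proof.
move=> /weakly_null_bidual_bounded[B B0 xB]; exists B => // n.
rewrite lipfree_normE; apply: dual_norm_le => // g.
have [f fg fn] := dual_of_lip g; rewrite -fg (le_trans (xB _ _))//.
by rewrite ler_wpM2l.
Qed.

(** The map sending [h] to the limit along [W] of its difference quotients is linear and bounded by
    [|h|], hence an element of the bidual, and weak nullity of [f] in the dual can be tested on
    it. *)
Lemma weakly_null_diff_quot (f : nat -> dual (lipfree o)) (g : nat -> lip0 o)
    (W : set_system (M * M)) {WU : UltraFilter W} :
  weakly_null f -> (forall n p, g n p = f n (free_delta o p)) ->
  (fun n => ulim W (diff_quot (g n))) @ \oo --> (0 : R^o).
Proof.
move=> /weakly_nullP f0 gf.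
pose q (h : dual (lipfree o)) (s : M * M) := diff_quot (fun p => h (free_delta o p)) s.
have qb h s : `|q h s| <= `|h|.
  apply: diff_quot_le; first exact: dual_norm_ge0.
  rewrite -linearB; apply: le_trans (dual_norm_bound _ _) _.
  by rewrite ler_wpM2l ?dual_norm_ge0 ?free_delta_dist.
have bq h : bdd (q h) by exists `|h|; exact: qb.
have [||h|E EE _] := @dual_of_bound _ (dual (lipfree o)) (fun h => ulim W (q h)) 1.
- by [].
- move=> a h k; rewrite -[RHS]/(a * ulim W (q h) + ulim W (q k)).
  rewrite -(ulim_posfun (U := W)).1//; congr (ulim W _); apply/funext => s.
  rewrite /q /diff_quot.
  rewrite -![(a *: h + k) _]/(a * h _ + k _).
  by ring.
- rewrite mul1r -[leRHS]mulr1 -(ulim1 (U := W)).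
  by apply: (posfun_norm_le (ulim_posfun (U := W))); exact: qb.
have -> : (fun n => ulim W (diff_quot (g n))) = (fun n => E (f n)).
  apply/funext => n; rewrite EE; congr (ulim W _); apply/funext => s.
  by rewrite /q /diff_quot !gf.
exact: f0.
Qed.

Lemma weakly_null_posfun (f : nat -> dual (lipfree o)) (g : nat -> lip0 o)
    (nu : (M * M -> R) -> R) :
  posfun nu -> weakly_null f -> (forall n p, g n p = f n (free_delta o p)) ->
  (forall n, `|g n| <= `|f n|) ->
  (fun n => nu (fun s => `|diff_quot (g n) s|)) @ \oo --> (0 : R^o).
Proof.
move=> nuP f0 gf gfn; have [B B0 fB] := weakly_null_dual_bounded f0.
apply: (@posfun_norm_cvg0 _ _ _ nuP _ B).
  by move=> n s; rewrite (le_trans (diff_quot_lip0 _ _))// (le_trans (gfn n)).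
by move=> W WU; apply: weakly_null_diff_quot f0 gf.
Qed.

End WeaklyNull.

(** * Grid interpolation of Lipschitz functions *)

Section EuclideanGeometry.
Context {R : realType} {d : nat}.
Local Notation E := (euclidean R d).
Implicit Types p q : E.

Definition gap p q i : R := `|p 0 i - q 0 i|.

Lemma gap_ge0 p q i : 0 <= gap p q i.
Proof. exact: normr_ge0. Qed.

Lemma gapC p q i : gap p q i = gap q p i.
Proof. exact: distrC. Qed.

Lemma gap_triangle p q u i : gap p u i <= gap p q i + gap q u i.
Proof. exact: ler_distD. Qed.

Lemma gap_le_dist p q i : gap p q i <= mdist p q.
Proof.
rewrite /gap euclidean_mdistE -sqrtr_sqr ler_wsqrtr// (bigD1 i)//= lerDl.
by apply: sumr_ge0 => j _; exact: sqr_ge0.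
Qed.

Lemma dist_le_sum_gap p q : mdist p q <= \sum_i gap p q i.
Proof.
have S0 : 0 <= \sum_i gap p q i by apply: sumr_ge0 => i _; exact: gap_ge0.
rewrite euclidean_mdistE -[leRHS]ger0_norm// -sqrtr_sqr ler_wsqrtr//.
rewrite expr2 mulr_sumr ler_sum// => i _.
rewrite -real_normK ?num_real// expr2 ler_wpM2r// /gap.
by rewrite (bigD1 i)//= lerDl sumr_ge0.
Qed.

Lemma dist_le_gap p q (c : R) :
  (forall i, gap p q i <= c) -> mdist p q <= c * d%:R.
Proof.
move=> h; apply: le_trans (dist_le_sum_gap p q) _.
apply: (@le_trans _ _ (\sum_(i < d) c)); first exact: ler_sum.
by rewrite sumr_const card_ord mulr_natr.
Qed.

Lemma midpoint_dist p q : exists m : E,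
  mdist p m = mdist p q / 2 /\ mdist m q = mdist p q / 2.
Proof.
exists (\row_i ((p 0 i + q 0 i) / 2)).
have half (s : R) : 0 <= s -> Num.sqrt (4^-1 * s) = Num.sqrt s / 2.
  move=> s0; rewrite sqrtrM; last by lra.
  have -> : (4^-1 : R) = 2^-1 ^+ 2 by field.
  by rewrite sqrtr_sqr ger0_norm 1?mulrC//; lra.
have s0 : 0 <= \sum_(i < d) (p 0 i - q 0 i) ^+ 2.
  by apply: sumr_ge0 => j _; exact: sqr_ge0.
rewrite !euclidean_mdistE -half// mulr_sumr.
by split; congr Num.sqrt; apply: eq_bigr => i _; rewrite mxE; field.
Qed.

(** Repeated bisection: midpoints halve distances exactly, so the constant [C] is not degraded in
    passing from scale [r] to scale [2 ^+ n * r]. *)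
Lemma lipschitz_local_global (g : E -> R) (C r : R) : 0 < r ->
  (forall p q, mdist p q < r -> `|g p - g q| <= C * mdist p q) ->
  forall p q, `|g p - g q| <= C * mdist p q.
Proof.
move=> r0 gC p q.
have step n : forall p q, mdist p q < 2 ^+ n * r -> `|g p - g q| <= C * mdist p q.
  elim: n => [|n IH] u v; first by rewrite expr0 mul1r; exact: gC.
  rewrite exprS => uv; have [m [um mv]] := midpoint_dist u v.
  have h1 : `|g u - g m| <= C * mdist u m by apply: IH; rewrite um; lra.
  have h2 : `|g m - g v| <= C * mdist m v by apply: IH; rewrite mv; lra.
  rewrite (le_trans (ler_distD (g m) _ _))// (le_trans (lerD h1 h2))// um mv; lra.
pose n := Num.bound (mdist p q / r).
apply: (step n); rewrite -ltr_pdivrMr//.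
have : mdist p q / r < n%:R by rewrite archi_boundP// divr_ge0// ?mdist_ge0// ltW.
move=> /lt_trans; apply.
by rewrite -natrX ltr_nat ltn_expl.
Qed.

End EuclideanGeometry.

(** * One-dimensional bump functions *)

Section Bumps.
Context {R : realType}.
Implicit Types x y : R.

Definition clamp x : R := Num.max 0 (Num.min 1 x).

Lemma clamp_itv x : 0 <= clamp x <= 1.
Proof. by rewrite /clamp le_max lexx ge_max ler01 ge_min lexx. Qed.

Lemma clamp0 x : x <= 0 -> clamp x = 0.
Proof. by move=> x0; rewrite /clamp; apply/max_idPl; rewrite ge_min x0 orbT. Qed.

Lemma clamp1 x : 1 <= x -> clamp x = 1.
Proof. by move=> x1; rewrite /clamp (min_idPl x1); apply/max_idPr. Qed.

Lemma clamp_le x y : x <= y -> clamp x <= clamp y.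
Proof. by move=> xy; rewrite /clamp le_max2// le_min2. Qed.

Lemma clamp_id x : 0 <= x <= 1 -> clamp x = x.
Proof. by move=> /andP[x0 x1]; rewrite /clamp (min_idPr x1); apply/max_idPr. Qed.

Lemma clamp_lip x y : `|clamp x - clamp y| <= `|x - y|.
Proof.
wlog xy : x y / x <= y.
  by move=> H; have [/H//|/ltW/H] := leP x y; rewrite distrC [leRHS]distrC.
rewrite distrC [leRHS]distrC ger0_norm ?subr_ge0 ?clamp_le// ger0_norm ?subr_ge0//.
have [x0|x0] := leP x 0.
  rewrite (clamp0 x0); have [y0|y0] := leP y 0; first by rewrite (clamp0 y0); lra.
  by have [y1|y1] := leP 1 y; [rewrite clamp1//|rewrite clamp_id]; lra.
have [x1|x1] := leP 1 x; first by rewrite !clamp1//; lra.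
rewrite (clamp_id (x := x)) ?(ltW x0) ?(ltW x1)//.
by have [y1|y1] := leP 1 y; [rewrite clamp1//|rewrite clamp_id]; lra.
Qed.

(* Both are differences of translated clamps, so that sums over integer
   translates telescope. *)
Definition tent x : R := clamp (x + 1) - clamp x.
Definition plateau x : R := clamp (x + 3) - clamp (x - 2).

Lemma tent_itv x : 0 <= tent x <= 1.
Proof.
have xx : clamp x <= clamp (x + 1) by apply: clamp_le; lra.
by have := clamp_itv x; have := clamp_itv (x + 1); rewrite /tent; lra.
Qed.

Lemma plateau_itv x : 0 <= plateau x <= 1.
Proof.
have xx : clamp (x - 2) <= clamp (x + 3) by apply: clamp_le; lra.
by have := clamp_itv (x - 2); have := clamp_itv (x + 3); rewrite /plateau; lra.
Qed.

Lemma tent_out x : 1 <= `|x| -> tent x = 0.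
Proof.
rewrite ler_normr /tent => /orP[x1|x1]; first by rewrite !clamp1; lra.
by rewrite !clamp0; lra.
Qed.

Lemma plateau_out x : 3 <= `|x| -> plateau x = 0.
Proof.
rewrite ler_normr /plateau => /orP[x1|x1]; first by rewrite !clamp1; lra.
by rewrite !clamp0; lra.
Qed.

Lemma plateau_in x : `|x| <= 2 -> plateau x = 1.
Proof.
by rewrite ler_norml /plateau => /andP[x1 x2]; rewrite clamp1 ?clamp0; lra.
Qed.

Lemma tent_lip x y : `|tent x - tent y| <= 2 * `|x - y|.
Proof.
have := clamp_lip (x + 1) (y + 1); have := clamp_lip x y.
have -> : x + 1 - (y + 1) = x - y by ring.
have -> : tent x - tent y = (clamp (x + 1) - clamp (y + 1)) - (clamp x - clamp y).
  by rewrite /tent; ring.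
by have := ler_normB (clamp (x + 1) - clamp (y + 1)) (clamp x - clamp y); lra.
Qed.

Lemma plateau_lip x y : `|plateau x - plateau y| <= 2 * `|x - y|.
Proof.
have := clamp_lip (x + 3) (y + 3); have := clamp_lip (x - 2) (y - 2).
have -> : x + 3 - (y + 3) = x - y by ring.
have -> : x - 2 - (y - 2) = x - y by ring.
have -> : plateau x - plateau y =
    (clamp (x + 3) - clamp (y + 3)) - (clamp (x - 2) - clamp (y - 2)).
  by rewrite /plateau; ring.
have := ler_normB (clamp (x + 3) - clamp (y + 3)) (clamp (x - 2) - clamp (y - 2)).
by lra.
Qed.

Lemma sum_tent (n : nat) x :
  \sum_(k < n) tent (x - k%:R) = clamp (x + 1) - clamp (x + 1 - n%:R).
Proof.
elim: n => [|n IH]; first by rewrite big_ord0 subr0 subrr.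
rewrite big_ord_recr /= IH /tent.
have -> : x - n%:R + 1 = x + 1 - n%:R by ring.
have -> : x + 1 - n.+1%:R = x - n%:R by rewrite -natr1; ring.
by ring.
Qed.

Lemma sum_tent_le1 (n : nat) x : \sum_(k < n) tent (x - k%:R) <= 1.
Proof.
rewrite sum_tent.
by have := clamp_itv (x + 1); have := clamp_itv (x + 1 - n%:R); lra.
Qed.

(** The plateau is the sum of the five tents translated by -2, ..., 2, and the integer translates of
    one tent sum to at most 1. *)
Lemma sum_plateau_le (n : nat) x : \sum_(k < n) plateau (x - k%:R) <= 5.
Proof.
have -> : \sum_(k < n) plateau (x - k%:R) =
    \sum_(k < n) tent (x + 2 - k%:R) + \sum_(k < n) tent (x + 1 - k%:R) +
    \sum_(k < n) tent (x - k%:R) + \sum_(k < n) tent (x - 1 - k%:R) +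
    \sum_(k < n) tent (x - 2 - k%:R).
  rewrite -!big_split /=; apply: eq_bigr => k _; rewrite /tent /plateau.
  have e1 : x + 2 - k%:R + 1 = x - k%:R + 3 by ring.
  have e2 : x + 1 - k%:R + 1 = x + 2 - k%:R by ring.
  have e3 : x - k%:R + 1 = x + 1 - k%:R by ring.
  have e4 : x - 1 - k%:R + 1 = x - k%:R by ring.
  have e5 : x - 2 - k%:R + 1 = x - 1 - k%:R by ring.
  have e6 : x - k%:R - 2 = x - 2 - k%:R by ring.
  by rewrite e1 e2 e3 e4 e5 e6; ring.
have h y := sum_tent_le1 n y.
by have := h (x + 2); have := h (x + 1); have := h x; have := h (x - 1);
  have := h (x - 2); lra.
Qed.

Lemma prod_diff_le (I : finType) (a b : I -> R) :
  (forall i, 0 <= a i <= 1) -> (forall i, 0 <= b i <= 1) ->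
  `|\prod_i a i - \prod_i b i| <= \sum_i `|a i - b i|.
Proof.
move=> ha hb; suff : forall s : seq I,
    [/\ 0 <= \prod_(i <- s) a i <= 1, 0 <= \prod_(i <- s) b i <= 1 &
     `|\prod_(i <- s) a i - \prod_(i <- s) b i| <= \sum_(i <- s) `|a i - b i|].
  by move=> /(_ (index_enum I))[].
elim=> [|i s [/andP[a0 a1] /andP[b0 b1] IH]].
  by rewrite !big_nil subrr normr0 ler01 lexx.
rewrite !big_cons; have /andP[ai0 ai1] := ha i; have /andP[bi0 bi1] := hb i.
rewrite !mulr_ge0// !mulr_ile1//; split=> //.
set A := \prod_(j <- s) a j in a0 a1 IH *; set B := \prod_(j <- s) b j in b0 b1 IH *.
have -> : a i * A - b i * B = (a i - b i) * A + b i * (A - B) by ring.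
rewrite (le_trans (ler_normD _ _))// !normrM (ger0_norm a0) (ger0_norm bi0).
apply: lerD; first by rewrite ler_piMr.
by apply: le_trans IH; rewrite ler_piMl.
Qed.

End Bumps.

Lemma dist_natr_ge1 (R : realType) (a b : nat) : a <> b -> 1 <= `|a%:R - b%:R : R|.
Proof.
move=> ab; rewrite ler_normr.
have [lt|lt|//] := ltngtP a b; last first.
  have : (b.+1%:R : R) <= a%:R by rewrite ler_nat.
  by rewrite -natr1 => h; apply/orP; left; lra.
have : (a.+1%:R : R) <= b%:R by rewrite ler_nat.
by rewrite -natr1 => h; apply/orP; right; lra.
Qed.

(** * Multilinear interpolation on a grid and its local slope *)

Section GridSmoothing.
Context {R : realType} {d : nat} (o : euclidean R d).
Local Notation E := (euclidean R d).
Context (t r : R) (N : nat).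
Hypotheses (t0 : 0 < t) (r0 : 0 < r).
Local Notation grid_index := {ffun 'I_d -> 'I_(N + N).+1}.
Implicit Types (p q : E) (z : grid_index) (phi : R -> R).

(** Centred so that [o] is itself a node, which lets interpolation preserve the value 0 at [o]. *)
Definition grid z : E := \row_i (o 0 i + t * ((z i)%:R - N%:R)).

Definition weight phi z p : R := \prod_i phi ((p 0 i - grid z 0 i) / t).

Lemma weight_itv phi z p : (forall x, 0 <= phi x <= 1) -> 0 <= weight phi z p <= 1.
Proof.
by move=> h; rewrite /weight; elim/big_ind : _ => // [|x y /andP[x0 x1] /andP[y0 y1]];
  rewrite ?ler01 ?lexx// mulr_ge0// mulr_ile1.
Qed.

Lemma weight_lip phi z p q : (forall x, 0 <= phi x <= 1) ->
  (forall x y, `|phi x - phi y| <= 2 * `|x - y|) ->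
  `|weight phi z p - weight phi z q| <= 2 * d%:R / t * mdist p q.
Proof.
move=> hi hl; rewrite /weight (le_trans (prod_diff_le _ _))//.
apply: (@le_trans _ _ (\sum_(i < d) (2 / t * mdist p q))).
  apply: ler_sum => i _; rewrite (le_trans (hl _ _))//.
  rewrite -mulrBl opprB addrA subrK normrM [`|t^-1|]gtr0_norm ?invr_gt0//.
  rewrite -mulrA ler_pM2l// mulrC ler_pM2l ?invr_gt0//.
  exact: gap_le_dist.
by rewrite sumr_const card_ord -mulr_natr; lra.
Qed.

Lemma sum_weightE phi p :
  \sum_z weight phi z p =
  \prod_i \sum_(k < (N + N).+1) phi ((p 0 i - o 0 i) / t + N%:R - k%:R).
Proof.
rewrite bigA_distr_bigA /=; apply: eq_bigr => z _; apply: eq_bigr => i _.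
by congr phi; rewrite mxE; field; rewrite gt_eqF.
Qed.

Definition in_box p := forall i, gap p o i <= N%:R * t.

Lemma sum_weight_tent p : in_box p -> \sum_z weight tent z p = 1.
Proof.
move=> pbox; rewrite sum_weightE big1// => i _; rewrite sum_tent.
have := pbox i; rewrite -ler_pdivrMr// -[t in _ / t](gtr0_norm t0) -normf_div.
rewrite ler_norml => /andP[h1 h2].
by rewrite clamp1 ?clamp0 ?subr0// -?natr1 ?natrD; lra.
Qed.

Lemma sum_weight_plateau p : 0 <= \sum_z weight plateau z p <= 5 ^+ d.
Proof.
rewrite sumr_ge0 => [|z _]; last by have /andP[] := weight_itv z p plateau_itv.
rewrite sum_weightE.
have -> : 5 ^+ d = \prod_(i < d) (5 : R) by rewrite prodr_const card_ord.
apply: ler_prod => i _; rewrite sum_plateau_le andbT sumr_ge0// => k _.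
by have /andP[] := plateau_itv ((p 0 i - o 0 i) / t + N%:R - k%:R).
Qed.

Lemma weight_neq0 phi (c : R) z p : (forall x, c <= `|x| -> phi x = 0) ->
  weight phi z p != 0 -> forall i, gap p (grid z) i < c * t.
Proof.
move=> hphi /prodf_neq0 h i; have := h i isT; apply: contraNT; rewrite -leNgt => hi.
apply/eqP/hphi; rewrite normf_div (gtr0_norm t0) ler_pdivlMr//.
Qed.

Lemma weight_tent_gap z p i : weight tent z p != 0 -> gap p (grid z) i < t.
Proof. by move=> /(weight_neq0 tent_out)/(_ i); rewrite mul1r. Qed.

Lemma weight_plateau_dist z p : weight plateau z p != 0 ->
  mdist (grid z) p <= 3 * t * d%:R.
Proof.
move=> /(weight_neq0 plateau_out) h; rewrite metric_sym.
by apply: dist_le_gap => i; exact: ltW.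
Qed.

Lemma weight_tent_dist z p : weight tent z p != 0 -> mdist (grid z) p <= t * d%:R.
Proof.
move=> h; rewrite metric_sym.
by apply: dist_le_gap => i; rewrite ltW// weight_tent_gap.
Qed.

Definition smooth (F : E -> R) p : R := \sum_z F (grid z) * weight tent z p.

(** The factor [2 * d%:R / t] is the Lipschitz constant of a tent weight. The plateau weights
    replace the indicator of the nodes near [p], so that the bound is itself Lipschitz in [p] when
    [F] is bounded and Lipschitz. *)
Definition slope (F : E -> R) p : R :=
  2 * d%:R / t * \sum_z weight plateau z p * `|F (grid z) - F p|.

Lemma slope_ge0 (F : E -> R) p : 0 <= slope F p.
Proof.
apply: mulr_ge0; first by rewrite divr_ge0 ?mulr_ge0// ltW.
by apply: sumr_ge0 => z _; rewrite mulr_ge0//; have /andP[] := weight_itv z p plateau_itv.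
Qed.

(** Inside the box the tents sum to 1, so [F p] can be subtracted from every nodal value. A node
    more than 2t away from [p] in some coordinate has zero tent weight at [p] and at [q]; at all
    others the plateau is 1. When [p] or [q] leaves the box, every node that matters lies where [F]
    vanishes. *)
Lemma smooth_local_lip (F : E -> R) p q :
  2 * r + 2 * t <= N%:R * t -> (forall p, 2 * r <= mdist p o -> F p = 0) ->
  mdist p q <= t -> `|smooth F p - smooth F q| <= slope F p * mdist p q.
Proof.
move=> Nt F0 pq; have t1 := t0.
have pqi i : gap p q i <= t by apply: le_trans pq; exact: gap_le_dist.
have [[bp bq]|nbox] := pselect (in_box p /\ in_box q).
  have -> : smooth F p - smooth F q =
      \sum_z (F (grid z) - F p) * (weight tent z p - weight tent z q).
    have -> : \sum_z (F (grid z) - F p) * (weight tent z p - weight tent z q) =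
        (smooth F p - smooth F q) -
        F p * (\sum_z weight tent z p - \sum_z weight tent z q).
      rewrite /smooth mulrBr !mulr_sumr -!sumrB; apply: eq_bigr => z _; ring.
    by rewrite !sum_weight_tent// subrr mulr0 subr0.
  rewrite (le_trans (ler_norm_sum _ _ _))// /slope mulrAC mulr_sumr ler_sum// => z _.
  rewrite normrM mulrC.
  have [pl1|] := pselect (forall i, `|(p 0 i - grid z 0 i) / t| <= 2).
    have -> : weight plateau z p = 1 by rewrite /weight big1// => i _; exact: plateau_in.
    by rewrite mul1r ler_wpM2r// weight_lip//; [exact: tent_itv|exact: tent_lip].
  move=> /existsNP[i /negP]; rewrite -ltNge => hi.
  have hi' : 2 * t < gap p (grid z) i.
    by move: hi; rewrite normf_div (gtr0_norm t0) ltr_pdivlMr.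
  have -> : weight tent z p = 0.
    apply/eqP; apply: contraT => /(weight_tent_gap i) h.
    by suff : 0 < 0 :> R; [rewrite ltxx|lra].
  have -> : weight tent z q = 0.
    apply/eqP; apply: contraT => /(weight_tent_gap i) h.
    have := gap_triangle p q (grid z) i; have := pqi i => ? ?.
    by suff : 0 < 0 :> R; [rewrite ltxx|lra].
  rewrite subrr normr0 mul0r mulr_ge0//.
    by rewrite mulr_ge0 ?mdist_ge0// divr_ge0 ?mulr_ge0// ltW.
  by rewrite mulr_ge0//; have /andP[] := weight_itv z p plateau_itv.
have [i hp hq] : exists2 i, N%:R * t - t < gap p o i &
    N%:R * t - t < gap q o i.
  have [bp|/existsNP[i /negP]] := pselect (in_box p); last first.
    rewrite -ltNge => hi; exists i; first by lra.
    by have := gap_triangle p q o i; have := pqi i; lra.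
  have /existsNP[i /negP] : ~ in_box q by move=> bq; exact: nbox.
  rewrite -ltNge => hi; exists i; last by lra.
  by have := gap_triangle q p o i; have := pqi i; rewrite (gapC p q); lra.
have out u : N%:R * t - t < gap u o i -> smooth F u = 0.
  move=> ui; rewrite /smooth big1// => z _.
  have [zo|zo] := leP (2 * r) (mdist (grid z) o); first by rewrite F0// mul0r.
  have -> : weight tent z u = 0; last by rewrite mulr0.
  apply/eqP; apply: contraT => /(weight_tent_gap i) h.
  have := gap_le_dist (grid z) o i; have := gap_triangle u (grid z) o i => ? ?.
  by suff : 0 < 0 :> R; [rewrite ltxx|lra].
by rewrite !out// subrr normr0 mulr_ge0 ?slope_ge0 ?mdist_ge0.
Qed.

Lemma slope_lip (F : E -> R) (B K : R) : (forall p, `|F p| <= B) -> 0 <= K ->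
  (forall p q, `|F p - F q| <= K * mdist p q) ->
  exists2 L, 0 <= L & forall p q, `|slope F p - slope F q| <= L * mdist p q.
Proof.
move=> FB K0 FK; have B0 : 0 <= B by exact: le_trans (FB o).
set c := 2 * d%:R / t.
have c0 : 0 <= c by rewrite divr_ge0 ?mulr_ge0// ltW.
exists (c * \sum_(z : grid_index) (c * (2 * B) + K)).
  rewrite mulr_ge0//; apply: sumr_ge0 => z _.
  by apply: addr_ge0 => //; do 2!apply: mulr_ge0 => //.
move=> p q; rewrite /slope -/c -mulrBr normrM (ger0_norm c0) -[leRHS]mulrA ler_wpM2l//.
rewrite -sumrB mulr_suml (le_trans (ler_norm_sum _ _ _))// ler_sum// => z _.
set a := weight plateau z p; set b := weight plateau z q.
set u := `|F (grid z) - F p|; set v := `|F (grid z) - F q|.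
have -> : a * u - b * v = (a - b) * v + a * (u - v) by ring.
have ab : `|a - b| <= c * mdist p q.
  by apply: weight_lip; [exact: plateau_itv|exact: plateau_lip].
have vB : v <= 2 * B.
  rewrite /v (le_trans (ler_normB _ _))//.
  by have := FB (grid z); have := FB q; lra.
have uv : `|u - v| <= K * mdist p q.
  apply: le_trans (FK p q); apply: le_trans (ler_dist_dist _ _) _.
  have -> : F (grid z) - F p - (F (grid z) - F q) = - (F p - F q) by ring.
  by rewrite normrN.
have /andP[a0 a1] := weight_itv z p plateau_itv.
rewrite (le_trans (ler_normD _ _))// [leRHS]mulrDl !normrM lerD//.
  by rewrite [leRHS]mulrAC ler_pM// /v normr_id.
by rewrite (ger0_norm a0) (le_trans _ uv)// ler_piMl.
Qed.

Lemma slope_out (F : E -> R) p : (forall p, 2 * r <= mdist p o -> F p = 0) ->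
  2 * r + 3 * t * d%:R <= mdist p o -> slope F p = 0.
Proof.
move=> F0 po; rewrite /slope big1 ?mulr0// => z _.
have td : 0 <= 3 * t * d%:R by rewrite !mulr_ge0// ltW.
have [->|bz] := eqVneq (weight plateau z p) 0; first by rewrite mul0r.
have := weight_plateau_dist bz; have := metric_triangle p (grid z) o.
rewrite (metric_sym p (grid z)) => h1 h2.
by rewrite !F0 ?subrr ?normr0 ?mulr0//; lra.
Qed.

Lemma smooth_center (F : E -> R) : F o = 0 -> smooth F o = 0.
Proof.
move=> Fo; rewrite /smooth big1// => z _.
have [zN|/existsNP[i ziN]] := pselect (forall i, z i = N :> nat).
  have -> : grid z = o by apply/rowP => i; rewrite mxE zN subrr mulr0 addr0.
  by rewrite Fo mul0r.
have -> : weight tent z o = 0; last by rewrite mulr0.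
rewrite /weight (bigD1 i)//= tent_out ?mul0r// mxE opprD addrA subrr sub0r.
rewrite mulNr normrN mulrAC divff ?gt_eqF// mul1r.
exact: dist_natr_ge1.
Qed.

Definition cutoff (f : E -> R) p : R := clamp (2 - mdist p o / r) * f p.

Lemma cutoff_out (f : E -> R) p : 2 * r <= mdist p o -> cutoff f p = 0.
Proof. by move=> h; rewrite /cutoff clamp0 ?mul0r// subr_le0 ler_pdivlMr. Qed.

Lemma cutoff_in (f : E -> R) p : mdist p o <= r -> cutoff f p = f p.
Proof.
move=> h; rewrite /cutoff clamp1 ?mul1r//.
have : mdist p o / r <= 1 by rewrite ler_pdivrMr// mul1r.
by lra.
Qed.

(** Leibniz rule: the clamp varies at rate 1/r, and [f p] is [diff_quot f (p, o)] times a distance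
    of at most 3r unless both cutoffs vanish. Expressing both terms by difference quotients of [f],
    rather than by its Lipschitz constant, is what makes the bound small for positive
    functionals. *)
Lemma cutoff_diff (f : E -> R) p q : f o = 0 -> mdist q p <= r ->
  `|cutoff f q - cutoff f p| <=
  (`|diff_quot f (q, p)| + 3 * `|diff_quot f (p, o)|) * mdist q p.
Proof.
move=> fo qp.
have D0 := mdist_ge0 q p.
have [po|po] := leP (mdist p o) (3 * r); last first.
  rewrite !cutoff_out ?subrr ?normr0; first by rewrite mulr_ge0// addr_ge0// mulr_ge0.
    by lra.
  by have := metric_triangle p q o; rewrite (metric_sym p q); lra.
set cq := clamp (2 - mdist q o / r); set cp := clamp (2 - mdist p o / r).
have -> : cutoff f q - cutoff f p = cq * (f q - f p) + (cq - cp) * f p.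
  by rewrite /cutoff -/cq -/cp; ring.
rewrite (le_trans (ler_normD _ _))// [leRHS]mulrDl lerD//.
  rewrite (normrM cq) (diff_quotE f q p) (normrM (diff_quot f _)) (ger0_norm D0).
  have := clamp_itv (2 - mdist q o / r); rewrite -/cq => /andP[c0 c1].
  by rewrite (ger0_norm c0) ler_piMl// mulr_ge0.
rewrite (normrM (cq - cp)).
have ccD : `|cq - cp| <= mdist q p / r.
  apply: le_trans (clamp_lip _ _) _.
  have -> : 2 - mdist q o / r - (2 - mdist p o / r) = (mdist p o - mdist q o) / r by ring.
  rewrite normf_div (gtr0_norm r0) ler_pM2r ?invr_gt0// ler_norml.
  have := metric_triangle p q o; have := metric_triangle q p o.
  by rewrite (metric_sym p q); lra.
have fp : `|f p| <= `|diff_quot f (p, o)| * (3 * r).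
  have := diff_quotE f p o; rewrite fo subr0 => ->.
  by rewrite (normrM (diff_quot f _)) ler_wpM2l// ger0_norm ?mdist_ge0.
apply: (@le_trans _ _ (mdist q p / r * (`|diff_quot f (p, o)| * (3 * r)))).
  exact: ler_pM.
by rewrite [leRHS]mulrAC [leRHS]mulrC le_eqVlt; apply/orP; left; apply/eqP; field; rewrite gt_eqF.
Qed.

(* The pairs of points at which [h] is sampled depend on [p] but not on [F], so
   that a positive functional of [pattern h] is a positive functional of [h]. *)
Definition pattern (h : E * E -> R) p : R :=
  \sum_z weight plateau z p * (h (grid z, p) + 3 * h (p, o)).

(** Nodes with nonzero plateau weight lie within [3 * t * d] of [p]. This distance cancels the 1/t
    in the slope and leaves [(2 d / t) (3 t d) = 6 d^2], independent of the mesh. *)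
Lemma slope_le_pattern (f : E -> R) p : f o = 0 -> 3 * t * d%:R <= r ->
  slope (cutoff f) p <= 6 * d%:R ^+ 2 * pattern (fun s => `|diff_quot f s|) p.
Proof.
move=> fo tr; rewrite /slope /pattern !mulr_sumr ler_sum// => z _.
have /andP[b0 b1] := weight_itv z p plateau_itv.
have [->|bz] := eqVneq (weight plateau z p) 0; first by rewrite !(mul0r,mulr0).
have zp := weight_plateau_dist bz.
set y := `|diff_quot f (grid z, p)| + _.
have y0 : 0 <= y by rewrite addr_ge0// mulr_ge0.
have h : `|cutoff f (grid z) - cutoff f p| <= y * (3 * t * d%:R).
  apply: le_trans (cutoff_diff fo (le_trans zp tr)) _.
  by rewrite ler_wpM2l.
have -> : 6 * d%:R ^+ 2 * (weight plateau z p * y) =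
    2 * d%:R / t * (weight plateau z p * (y * (3 * t * d%:R))).
  by field; rewrite gt_eqF.
by apply: ler_wpM2l; [rewrite divr_ge0 ?mulr_ge0// ltW|exact: ler_wpM2l].
Qed.

Lemma smooth_cutoff_approx (f : E -> R) (K : R) p : f o = 0 -> 0 <= K ->
  (forall p q, `|f p - f q| <= K * mdist p q) -> t * d%:R <= r ->
  r <= N%:R * t -> mdist p o <= r ->
  `|smooth (cutoff f) p - f p| <= 4 * K * (t * d%:R).
Proof.
move=> fo K0 fK tr rN po.
have pbox : in_box p.
  by move=> i; apply: le_trans (gap_le_dist p o i) _; exact: le_trans rN.
set C := 4 * K * _.
rewrite -(cutoff_in f po) -[cutoff f p]mulr1 -(sum_weight_tent pbox) mulr_sumr -sumrB.
rewrite (le_trans (ler_norm_sum _ _ _))// -[leRHS]mulr1 -(sum_weight_tent pbox) mulr_sumr.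
rewrite ler_sum// => z _; rewrite -mulrBl normrM.
have /andP[b0 b1] := weight_itv z p tent_itv; rewrite (ger0_norm b0).
have [->|bz] := eqVneq (weight tent z p) 0; first by rewrite !mulr0.
have zp := weight_tent_dist bz.
rewrite ler_wpM2r//; apply: le_trans (cutoff_diff fo (le_trans zp tr)) _.
have dq s : `|diff_quot f s| <= K by exact: diff_quot_le.
apply: ler_pM; [by rewrite addr_ge0// mulr_ge0|exact: mdist_ge0| |exact: zp].
by have := dq (grid z, p); have := dq (p, o); lra.
Qed.

(** The tents sum to 1 at [p], so one of them does not vanish there. *)
Lemma grid_net p : in_box p -> exists z, mdist (grid z) p <= t * d%:R.
Proof.
move=> pbox; apply: contrapT => nz.
have := sum_weight_tent pbox; rewrite big1 => [/eqP|z _].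
  by rewrite eq_sym oner_eq0.
by apply/eqP; apply: contraT => /weight_tent_dist h; case: nz; exists z.
Qed.

End GridSmoothing.

(** * A single scale parameter: mesh to zero, cutoff radius to infinity *)

Section Scales.
Context {R : realType} {d : nat} (o : euclidean R d).
Local Notation E := (euclidean R d).
Implicit Types (p q : E) (f : E -> R) (m : nat).

(** The three parameters are tied to one index. The factor [3 * d + 1] in the radius ensures
    [3 * mesh m * d <= cut_radius m], and [steps] is chosen to make [2 * cut_radius m + 2 * mesh m =
    steps m * mesh m]. *)
Definition mesh m : R := m.+1%:R^-1.
Definition cut_radius m : R := (3 * d + 1)%:R * m.+1%:R.
Definition steps m : nat := (2 * ((3 * d + 1) * m.+1 * m.+1) + 2)%N.

Definition smoothing m f : E -> R :=
  smooth o (mesh m) (steps m) (cutoff o (cut_radius m) f).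
Definition slope_bound m f : E -> R :=
  slope o (mesh m) (steps m) (cutoff o (cut_radius m) f).
Definition pattern_at m (h : E * E -> R) : E -> R :=
  pattern o (mesh m) (steps m) h.

Lemma mesh_gt0 m : 0 < mesh m. Proof. by rewrite invr_gt0. Qed.

Lemma cut_radius_ge m : m.+1%:R <= cut_radius m.
Proof. by rewrite /cut_radius ler_peMl// ler1n addn1. Qed.

Lemma cut_radius_gt0 m : 0 < cut_radius m.
Proof. by apply: lt_le_trans (cut_radius_ge m). Qed.

Lemma mesh_cut_radius m : 3 * mesh m * d%:R <= cut_radius m.
Proof.
have m1 : mesh m <= 1 by rewrite /mesh invf_le1// ler1n.
apply: (@le_trans _ _ (3 * d + 1)%:R); last by rewrite /cut_radius ler_peMr// ler1n.
by rewrite natrD natrM; have := ler0n R d; have := mesh_gt0 m; nra.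
Qed.

Lemma mesh_steps m : 2 * cut_radius m + 2 * mesh m <= (steps m)%:R * mesh m.
Proof.
rewrite le_eqVlt; apply/orP; left; apply/eqP; rewrite /steps /cut_radius /mesh.
have k0 : 0 < m.+1%:R :> R by [].
by rewrite !(natrD, natrM); field; rewrite gt_eqF.
Qed.

Lemma mesh_cvg0 (e : R) : 0 < e -> \forall m \near \oo, mesh m <= e.
Proof.
move=> e0; have := nbhs_infty_ger (e^-1); apply: filterS => m em.
rewrite /mesh invf_ple ?posrE//.
by rewrite (le_trans em)// ler_nat.
Qed.

Lemma pattern_itv m (h : E * E -> R) (B : R) p :
  (forall s, 0 <= h s <= B) -> 0 <= pattern_at m h p <= 4 * B * 5 ^+ d.
Proof.
move=> hB; have h0 s : 0 <= h s by have /andP[] := hB s.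
have hle s : h s <= B by have /andP[] := hB s.
have B0 : 0 <= B by apply: le_trans (h0 (o, o)) (hle _).
have b0 z : 0 <= weight o (mesh m) (N := steps m) plateau z p.
  by have /andP[] := weight_itv o (mesh m) z p plateau_itv.
apply/andP; split.
  by apply: sumr_ge0 => z _; rewrite mulr_ge0// addr_ge0// mulr_ge0.
apply: (@le_trans _ _ (4 * B * \sum_z weight o (mesh m) (N := steps m) plateau z p)).
  rewrite mulr_sumr ler_sum// => z _; rewrite mulrC ler_wpM2r//.
  by have := hle (grid o (mesh m) z, p); have := hle (p, o); lra.
rewrite ler_wpM2l//; first by rewrite mulr_ge0.
by have /andP[] := sum_weight_plateau o (steps m) (mesh_gt0 m) p.
Qed.

Lemma pattern_linear m (a : R) (h k : E * E -> R) p :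
  pattern_at m (fun s => a * h s + k s) p = a * pattern_at m h p + pattern_at m k p.
Proof.
rewrite /pattern_at /pattern mulr_sumr -big_split /=; apply: eq_bigr => z _; ring.
Qed.

Lemma pattern_bdd m (h : E * E -> R) :
  bdd h -> bdd (fun s : E * E => pattern_at m h s.1).
Proof.
move=> bh; have bb z : bdd (fun p => weight o (mesh m) (N := steps m) plateau z p).
  by apply: (@bdd_itv _ _ _ 1) => p; apply: weight_itv; exact: plateau_itv.
apply: (bdd_comp fst); rewrite /pattern_at /pattern; apply: bdd_sum => z.
apply: bddM => //; apply: bddD; first exact: (bdd_comp (fun p => (grid o (mesh m) z, p))).
by apply: bddM; [exact: bdd_cst|exact: (bdd_comp (fun p => (p, o)))].
Qed.

(** [pattern_at m] is a positive linear operator, so composing with it transports positive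
    functionals. The mass grows by at most a factor independent of [m], as taking a limit in [m]
    requires. *)
Lemma posfun_pattern m (nu : (E * E -> R) -> R) : posfun nu ->
  posfun (fun h => nu (fun s => pattern_at m h s.1)) /\
  nu (fun s => pattern_at m (fun=> 1) s.1) <= 4 * 5 ^+ d * nu (fun=> 1).
Proof.
move=> nuP; split; [split=> [a h k bh bk|h bh h0]|].
- rewrite -nuP.1; [|exact: pattern_bdd|exact: pattern_bdd].
  by congr (nu _); apply/funext => s; rewrite pattern_linear.
- apply: nuP.2 => [|s]; first exact: pattern_bdd.
  have [M hM] := bh; have hM' u : 0 <= h u <= M.
    by rewrite h0 (le_trans (ler_norm _)).
  by have /andP[] := pattern_itv m s.1 hM'.
- apply: posfun_le_cst => //; first by apply: pattern_bdd; exact: bdd_cst.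
  move=> s; have /andP[_] : 0 <= pattern_at m (fun=> 1) s.1 <= 4 * 1 * 5 ^+ d.
    by apply: pattern_itv => u; rewrite ler01 lexx.
  by rewrite mulr1.
Qed.

Lemma slope_bound_ge0 m f p : 0 <= slope_bound m f p.
Proof. by apply: slope_ge0; exact: mesh_gt0. Qed.

Lemma smoothing_local_lip m f p q : mdist p q <= mesh m ->
  `|smoothing m f p - smoothing m f q| <= slope_bound m f p * mdist p q.
Proof.
apply: smooth_local_lip; [exact: mesh_gt0|exact: mesh_steps|].
by move=> u; apply: cutoff_out; exact: cut_radius_gt0.
Qed.

Lemma smoothing_center m f : f o = 0 -> smoothing m f o = 0.
Proof.
by move=> fo; apply: smooth_center; [exact: mesh_gt0|rewrite /cutoff fo mulr0].
Qed.

Lemma slope_bound_out m f : exists rho, forall p, rho <= mdist p o -> slope_bound m f p = 0.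
Proof.
exists (2 * cut_radius m + 3 * mesh m * d%:R) => p; apply: slope_out; first exact: mesh_gt0.
by move=> u; apply: cutoff_out; exact: cut_radius_gt0.
Qed.

Lemma slope_bound_le_pattern m f p : f o = 0 ->
  slope_bound m f p <= 6 * d%:R ^+ 2 * pattern_at m (fun s => `|diff_quot f s|) p.
Proof.
by move=> fo; apply: slope_le_pattern => //;
  [exact: mesh_gt0|exact: cut_radius_gt0|exact: mesh_cut_radius].
Qed.

Section Lipschitz.
Context (f : E -> R) (K : R).
Hypotheses (K0 : 0 <= K) (fo : f o = 0).
Hypothesis fK : forall p q, `|f p - f q| <= K * mdist p q.

Lemma diff_quot_itv s : 0 <= `|diff_quot f s| <= K.
Proof. by rewrite normr_ge0 diff_quot_le. Qed.

Lemma slope_bound_le m p : slope_bound m f p <= 24 * d%:R ^+ 2 * 5 ^+ d * K.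
Proof.
apply: le_trans (slope_bound_le_pattern m p fo) _.
have /andP[_] := pattern_itv m p diff_quot_itv => h.
have -> : 24 * d%:R ^+ 2 * 5 ^+ d * K = 6 * d%:R ^+ 2 * (4 * K * 5 ^+ d) by ring.
by rewrite ler_wpM2l// mulr_ge0// sqr_ge0.
Qed.

Lemma cutoff_lip m p q :
  `|cutoff o (cut_radius m) f p - cutoff o (cut_radius m) f q| <= 4 * K * mdist p q.
Proof.
apply: (@lipschitz_local_global _ _ _ _ (cut_radius m)) => [|u v uv]; first exact: cut_radius_gt0.
apply: le_trans (cutoff_diff (cut_radius_gt0 m) fo (ltW uv)) _.
rewrite ler_wpM2r ?mdist_ge0//.
by have /andP[_] := diff_quot_itv (u, v); have /andP[_] := diff_quot_itv (v, o); lra.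
Qed.

Lemma slope_bound_lip m : exists2 L, 0 <= L &
  forall p q, `|slope_bound m f p - slope_bound m f q| <= L * mdist p q.
Proof.
apply: (slope_lip o (steps m) (mesh_gt0 m) (B := 4 * K * (2 * cut_radius m)) _ _ (@cutoff_lip m)).
  move=> p; have rm := cut_radius_gt0 m.
  have [po|po] := leP (2 * cut_radius m) (mdist p o).
    by rewrite cutoff_out// normr0 !mulr_ge0// ltW.
  have := cutoff_lip m p o; rewrite {2}/cutoff fo mulr0 subr0 => /le_trans; apply.
  by rewrite ler_wpM2l ?mulr_ge0// ltW.
by rewrite mulr_ge0.
Qed.

Lemma smoothing_lip m p q :
  `|smoothing m f p - smoothing m f q| <= 24 * d%:R ^+ 2 * 5 ^+ d * K * mdist p q.
Proof.
apply: (@lipschitz_local_global _ _ _ _ (mesh m)) => [|u v uv]; first exact: mesh_gt0.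
apply: le_trans (smoothing_local_lip f (ltW uv)) _.
by rewrite ler_wpM2r ?mdist_ge0 ?slope_bound_le.
Qed.

Lemma smoothing_approx (rho e : R) : 0 < e ->
  \forall m \near \oo, forall p, mdist p o <= rho -> `|smoothing m f p - f p| <= e.
Proof.
move=> e0; have c0 : 0 < 4 * K * d%:R + 1 by rewrite ltr_wpDl// !mulr_ge0.
have := mesh_cvg0 (divr_gt0 e0 c0); have := nbhs_infty_ger rho.
apply: filterS2 => m rm me p po.
have h : mesh m * d%:R <= cut_radius m.
  by have := mesh_cut_radius m; have := mulr_ge0 (ltW (mesh_gt0 m)) (ler0n R d); lra.
have h' : cut_radius m <= (steps m)%:R * mesh m.
  by have := mesh_steps m; have := cut_radius_gt0 m; have := mesh_gt0 m; lra.
apply: le_trans (smooth_cutoff_approx (mesh_gt0 m) (cut_radius_gt0 m) fo K0 fK h h' _) _.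
  apply: le_trans po (le_trans rm (le_trans _ (cut_radius_ge m))).
  by rewrite ler_nat.
have := mesh_gt0 m; move: me; rewrite ler_pdivlMr// => me m0.
have -> : 4 * K * (mesh m * d%:R) = mesh m * (4 * K * d%:R) by ring.
by lra.
Qed.

Lemma smoothing_cvg p : (fun m => smoothing m f p) @ \oo --> (f p : R^o).
Proof.
apply/cvgrPdist_le => e e0; have := smoothing_approx (mdist p o) e0.
by apply: filterS => m /(_ p); rewrite lexx distrC; exact.
Qed.

End Lipschitz.

(** As in Arzela-Ascoli: the nodes of a fine grid form a finite net of the ball, on which pointwise
    convergence is uniform, and the common constant [K] carries it to the whole ball. *)
Lemma equilipschitz_cvg0 (g : nat -> E -> R) (K rho e : R) : 0 <= K ->
  (forall n p q, `|g n p - g n q| <= K * mdist p q) ->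
  (forall p, (fun n => g n p) @ \oo --> (0 : R^o)) -> 0 < e ->
  \forall n \near \oo, forall p, mdist p o <= rho -> `|g n p| <= e.
Proof.
move=> K0 gK g0 e0.
have c0 : 0 < 2 * (K * d%:R + 1) by rewrite mulr_gt0// ltr_wpDl// mulr_ge0.
have e2 : 0 < e / 2 by lra.
have [m [me rm]] : exists m, mesh m <= e / (2 * (K * d%:R + 1)) /\ rho <= m%:R.
  by have [m [? ?]] := filter_ex (filterI (mesh_cvg0 (divr_gt0 e0 c0)) (nbhs_infty_ger rho));
    exists m.
have : \forall n \near \oo, forall z, `|g n (grid o (mesh m) (N := steps m) z)| <= e / 2.
  apply: filter_forall => z.
  have /cvgrPdist_le/(_ _ e2) := g0 (grid o (mesh m) z).
  by apply: filterS => n; rewrite sub0r normrN.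
apply: filterS => n gz p po.
have pbox : in_box o (mesh m) (steps m) p.
  move=> i; apply: le_trans (gap_le_dist p o i) _; apply: le_trans po _.
  have := mesh_steps m; have := cut_radius_ge m; have := mesh_gt0 m; have := cut_radius_gt0 m.
  by move: rm; rewrite -natr1; lra.
have [z zp] := grid_net (mesh_gt0 m) pbox.
have -> : g n p = (g n p - g n (grid o (mesh m) z)) + g n (grid o (mesh m) z) by rewrite subrK.
rewrite (le_trans (ler_normD _ _))// [leRHS]splitr lerD//.
apply: le_trans (gK _ _ _) _; rewrite metric_sym.
apply: le_trans (ler_wpM2l K0 zp) _.
move: me; rewrite ler_pdivlMr// => me; have := mesh_gt0 m.
have -> : K * (mesh m * d%:R) = mesh m * (K * d%:R) by ring.
by lra.
Qed.

End Scales.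

(** * Extraction of a uniformly Lipschitz series *)

Section LocalizedMultiplication.
Context {R : realType} {d : nat} (o : euclidean R d).
Local Notation E := (euclidean R d).
Context (phi : E -> R) (L rho : R).
Hypotheses (L0 : 0 <= L) (phi01 : forall p, 0 <= phi p <= 1).
Hypothesis phiL : forall p q, `|phi p - phi q| <= L * mdist p q.
Hypothesis phi1 : forall p, rho <= mdist p o -> phi p = 1.

(** Leibniz rule. Since [phi] is constant beyond [rho], its variation only meets values of [g] on a
    ball; the extra 1 in the radius covers [q] at distance at most 1 from [p]. *)
Lemma mul_local_lip (g : E -> R) (w : R) p q : 0 <= w ->
  (forall p, mdist p o <= rho + 1 -> `|g p| <= w) -> mdist p q <= 1 ->
  `|phi p * g p - phi q * g q| <= phi p * `|g p - g q| + L * w * mdist p q.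
Proof.
move=> w0 gw pq; have /andP[p0 _] := phi01 p.
have D0 := mdist_ge0 p q.
have -> : phi p * g p - phi q * g q = phi p * (g p - g q) + (phi p - phi q) * g q by ring.
rewrite (le_trans (ler_normD _ _))// lerD//; first by rewrite normrM (ger0_norm p0).
have [qo|qo] := leP (mdist q o) (rho + 1).
  by rewrite normrM mulrAC ler_pM// gw.
have := metric_triangle q p o; rewrite (metric_sym q p) => tri.
by rewrite !phi1 ?subrr ?mul0r ?normr0 ?mulr_ge0//; lra.
Qed.

(** What multiplication by [phi] loses. As [1 - phi] vanishes beyond [rho], the estimate holds for
    all pairs, near or far, and can be integrated against a functional on pairs. *)
Lemma compl_mul_lip (g : E -> R) (K w : R) p q : 0 <= w ->
  (forall p q, `|g p - g q| <= K * mdist p q) ->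
  (forall p, mdist p o <= rho -> `|g p| <= w) ->
  `|(1 - phi p) * g p - (1 - phi q) * g q| <= (K * (1 - phi p) + L * w) * mdist p q.
Proof.
move=> w0 gK gw; have /andP[p0 p1] := phi01 p.
have D0 := mdist_ge0 p q.
have K0 : 0 <= K * mdist p q by apply: le_trans (gK p q).
have p1' : 0 <= 1 - phi p by lra.
have KD : 0 <= K * (1 - phi p) * mdist p q by rewrite mulrAC mulr_ge0.
have [qo|qo] := leP (mdist q o) rho.
  have -> : (1 - phi p) * g p - (1 - phi q) * g q =
    (1 - phi p) * (g p - g q) + (phi q - phi p) * g q by ring.
  rewrite (le_trans (ler_normD _ _))// [leRHS]mulrDl lerD//.
    by rewrite normrM (ger0_norm p1') mulrAC mulrC ler_wpM2r.
  by rewrite normrM distrC mulrAC ler_pM// gw.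
rewrite (phi1 (ltW qo)) subrr mul0r subr0.
have [po|po] := leP (mdist p o) rho.
  rewrite [leRHS]mulrDl -[leLHS]add0r lerD// normrM -(phi1 (ltW qo)) distrC mulrAC.
  by rewrite ler_pM// gw.
rewrite (phi1 (ltW po)) subrr mul0r normr0 mulr0 add0r.
by rewrite !mulr_ge0.
Qed.

Lemma mul_lip0 (g : lip0 o) : exists2 G : lip0 o, (forall p, G p = phi p * g p) &
  `|G| <= (1 + L * (`|rho| + 1)) * `|g|.
Proof.
have n0 : 0 <= `|g| by [].
apply: lip0_of_bound; first by rewrite lip0_base mulr0.
  by rewrite mulr_ge0// addr_ge0// mulr_ge0// addr_ge0.
apply: (@lipschitz_local_global _ _ _ _ 1) => // p q pq.
apply: le_trans (@mul_local_lip g (`|g| * (`|rho| + 1)) p q _ _ (ltW pq)) _.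
- by rewrite mulr_ge0// addr_ge0.
- move=> u uo; rewrite -[g u]subr0 -(lip0_base g).
  apply: le_trans (lip_norm_bound _ _ _) _; rewrite ler_wpM2l//.
  by have := ler_norm rho; lra.
have /andP[p0 p1] := phi01 p.
rewrite mulrDl mul1r [leRHS]mulrDl lerD//.
  apply: le_trans (lip_norm_bound g p q); exact: ler_piMl.
by rewrite [`|g| * _]mulrC mulrA.
Qed.

End LocalizedMultiplication.

Lemma posfun_ulim {R : realType} (T S : Type) (U : set_system T) {UU : UltraFilter U}
    (nu : T -> (S -> R) -> R) (B : R) :
  (forall t, posfun (nu t)) -> (forall t, nu t (fun=> 1) <= B) ->
  posfun (fun h => ulim U (fun t => nu t h)) /\
  (forall h, bdd h -> bdd (fun t => nu t h)) /\ ulim U (fun t => nu t (fun=> 1)) <= B.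
Proof.
move=> nuP nuB.
have bnu h : bdd h -> bdd (fun t => nu t h).
  move=> [M hM]; exists (`|M| * B) => t.
  apply: (@le_trans _ _ (`|M| * nu t (fun=> 1))).
    by apply: posfun_norm_le => // s; exact: le_trans (hM s) (ler_norm M).
  by rewrite ler_wpM2l.
split; last first.
  by split=> //; apply: ulim_le; [apply: bnu; exact: bdd_cst|exact: nearW].
split=> [a h k bh bk|h bh h0].
  rewrite -(ulim_posfun (U := U)).1; [|exact: bnu|exact: bnu].
  by congr (ulim U _); apply/funext => t; rewrite (nuP t).1.
by apply: (ulim_posfun (U := U)).2; [exact: bnu|move=> t; exact: (nuP t).2].
Qed.

Lemma near_all_seq (T : Type) (F : set_system T) {FF : Filter F} (ns : seq nat)
    (P : nat -> T -> Prop) :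
  (forall j, F [set t | P j t]) -> F [set t | forall j, j \in ns -> P j t].
Proof.
move=> FP; elim: ns => [|j ns IH]; first exact: nearW.
apply: filterS2 (FP j) IH => t Pj Pns i.
by rewrite in_cons => /predU1P[->|/Pns].
Qed.

Section Construction.
Context {R : realType} {d : nat} {o : euclidean R d}.
Local Notation E := (euclidean R d).
Context (x : nat -> lipfree o) (g : nat -> lip0 o).
Context (nu : nat -> (E * E -> R) -> R) (U : set_system nat) {UU : UltraFilter U}.
Context (K B delta0 : R).
Hypotheses (ooU : \oo `<=` U) (B0 : 0 <= B) (delta_gt0 : 0 < delta0).
Hypothesis gK : forall n, `|g n| <= K.
Hypothesis g0 : forall p, (fun n => g n p) @ \oo --> (0 : R^o).
Hypothesis x0 : forall h, (fun n => lipfree_val (x n) h) @ \oo --> (0 : R^o).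
Hypothesis nuP : forall n, posfun (nu n).
Hypothesis nuB : forall n, nu n (fun=> 1) <= B.
Hypothesis nuE : forall n h, lipfree_val (x n) h = nu n (diff_quot h).
Hypothesis g_nu0 : (fun n => ulim U (fun m => ulim U (fun k =>
  nu k (fun s => pattern_at o m (fun s => `|diff_quot (g n) s|) s.1)))) @ \oo
  --> (0 : R^o).
Hypothesis xg : U [set n | delta0 <= lipfree_val (x n) (g n)].

(** The bound on [slope_bound] that is uniform in the mesh, plus 1. Dividing by it puts slopes in
    [0, 1], and being at least 1 it makes the quotient no larger than the slope. *)
Definition slope_scale : R := 24 * d%:R ^+ 2 * 5 ^+ d * K + 1.

(* [S] is the partial sum built so far, [phi] the remaining cutoff, [tol] the
   remaining tolerance and [ns] the indices already treated. The local slope of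
   [S] is paid for by the mass [1 - phi] already removed from the cutoff. *)
Definition stage (S : lip0 o) (phi : E -> R) (tol : R) (ns : seq nat) : Prop :=
  [/\ 0 < tol <= delta0 / 2,
    [/\ forall p, 0 <= phi p <= 1,
        exists2 L, 0 <= L & forall p q, `|phi p - phi q| <= L * mdist p q &
        exists rho, forall p, rho <= mdist p o -> phi p = 1],
    U [set n | nu n (fun s => 1 - phi s.1) + tol <= delta0 / (8 * (K + 1))],
    exists2 r, 0 < r & forall p q, mdist p q < r ->
      `|S p - S q| <= (slope_scale * (1 - phi p) + 1 - tol) * mdist p q &
    forall j, j \in ns -> delta0 / 2 + tol <= lipfree_val (x j) S].

Let K0 : 0 <= K. Proof. by apply: le_trans (gK 0%N). Qed.

Let gKlip n p q : `|g n p - g n q| <= K * mdist p q.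
Proof.
apply: le_trans (lip_norm_bound (g n) p q) _.
by rewrite ler_wpM2r ?mdist_ge0//; exact: gK.
Qed.

Lemma slope_scale_ge1 : 1 <= slope_scale.
Proof. by rewrite lerDr !mulr_ge0// exprn_ge0. Qed.

Lemma stage_step (S : lip0 o) (phi : E -> R) (tol : R) (ns : seq nat) (N : nat) :
  stage S phi tol ns ->
  exists (S' : lip0 o) phi' tol' n, (N < n)%N /\ stage S' phi' tol' (n :: ns).
Proof.
move=> [/andP[tol0 told] [phi01 [L L0 phiL] [rho phi1]] Ures [r r0 Sslope] Sns].
have A1 := slope_scale_ge1; set A := slope_scale in A1 Sslope.
have A0 : 0 < A by exact: lt_le_trans A1.
(* For the new index, the losses amount to [delta0 / 8 + 2 * e]; what remains is at least
   [delta0 / 2 + tol / 2] precisely because [tol <= delta0 / 2]. Old indices lose at most [e]. *)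
have [e [e0 eE]] : exists e : R, 0 < e /\ e = tol / 8.
  by exists (tol / 8); rewrite divr_gt0.
have LB0 : 0 < 2 * (L + 1) * (B + 1) by rewrite !mulr_gt0// ltr_wpDl.
(* [w] bounds the new function on the ball where [phi] varies: [L * w <= e / 2] controls the Leibniz
   error in slopes, and [L * w * B <= e / 2] the same error integrated against [nu n]. *)
pose w := e / (2 * (L + 1) * (B + 1)); have w0 : 0 < w by rewrite divr_gt0.
have Lw : 2 * (L + 1) * (B + 1) * w = e by rewrite /w mulrC divfK// gt_eqF.
have Lw0 : 0 <= L * w by rewrite mulr_ge0// ltW.
have Lw1 : L * w <= e / 2.
  have : 0 <= L * w * B by rewrite mulr_ge0.
  have : 0 <= w * B by rewrite mulr_ge0// ltW.
  by move: Lw; rewrite !mulrDr !mulrDl !mulr1 !mul1r; nra.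
have LwB : L * w * B <= e / 2.
  have : 0 <= w * B by rewrite mulr_ge0// ltW.
  by move: Lw; rewrite !mulrDr !mulrDl !mulr1 !mul1r; nra.
have /choice[mul mulP] : forall h : lip0 o, exists G : lip0 o,
    (forall p, G p = phi p * h p) /\ `|G| <= (1 + L * (`|rho| + 1)) * `|h|.
  move=> h; have [G GE Gn] := mul_lip0 L0 phi01 phiL phi1 h.
  by exists G.
have mulE h p : mul h p = phi p * h p by exact: (mulP h).1.
set C := 1 + L * (`|rho| + 1) in mulP.
have C0 : 0 <= C by rewrite addr_ge0// mulr_ge0// addr_ge0.
pose e3 := tol / (2 * (6 * d%:R ^+ 2 + 1)).
have d0 : 0 <= 6 * d%:R ^+ 2 :> R by rewrite mulr_ge0// exprn_ge0.
have e30 : 0 < e3 by rewrite divr_gt0// mulr_gt0// ltr_wpDl.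
have e3d : 6 * d%:R ^+ 2 * e3 <= tol / 2.
  have -> : tol / 2 = (6 * d%:R ^+ 2 + 1) * e3 by rewrite /e3; field; rewrite gt_eqF// ltr_wpDl.
  by rewrite ler_wpM2r ?lerDl// ltW.
have e20 : 0 < e / 2 by rewrite divr_gt0.
have U3 : U [set n | `|lipfree_val (x n) S| <= e].
  have /cvgrPdist_le/(_ _ e0) := x0 S; move=> h; apply: ooU.
  by apply: filterS h => n; rewrite sub0r normrN.
have U4 : U [set n | forall p, mdist p o <= rho + 1 -> `|g n p| <= w / 2].
  have w20 : 0 < w / 2 by rewrite divr_gt0.
  by apply: ooU; exact: (equilipschitz_cvg0 o (g := fun n => g n : E -> R)
    (rho + 1) K0 gKlip g0 w20).
(* The functions [phi g_n] are bounded in Lip_0 and tend to 0 pointwise, so the finitely many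
   earlier [x j] cease to see them. *)
have U5 : U [set n | forall j, j \in ns -> `|lipfree_val (x j) (mul (g n))| <= e / 2].
  apply: near_all_seq => j; apply: ooU.
  have gn0 : (fun n => lipfree_val (x j) (mul (g n))) @ \oo --> lipfree_val (x j) 0.
    apply: (@lipfree_cvg_pointwise _ _ _ _ _ _ _ _ _ (C * K)).
    - by move=> n; apply: le_trans (mulP _).2 _; rewrite ler_wpM2l.
    - by rewrite normr0 mulr_ge0.
    - move=> p; under eq_fun do rewrite mulE.
      suff : (fun n => phi p * g n p) @ \oo --> (phi p * 0 : R^o) by rewrite mulr0.
      by apply: (@cvgM R); [exact: cvg_cst|exact: g0].
  move: gn0; rewrite linear0 => /cvgrPdist_le/(_ _ e20).
  by apply: filterS => n; rewrite sub0r normrN.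
(* Smallness is secured before the mesh is known: [n] is good for the iterated limit, which then
   supplies a suitable [m] and, for that [m], almost all [k] along [U]. *)
have U6 : U [set n | ulim U (fun m => ulim U (fun k =>
  nu k (fun s => pattern_at o m (fun s => `|diff_quot (g n) s|) s.1))) < e3].
  have /cvgrPdist_lt/(_ _ e30) := g_nu0; move=> h; apply: ooU.
  by apply: filterS h => n; rewrite sub0r normrN => /(le_lt_trans (ler_norm _)).
have U7 : U [set n | (N < n)%N] by apply: ooU; exact: nbhs_infty_gt.
have [n [[[[[[xgn Resn] xS] gsmall] xmul] nusmall] Nn]] :=
  filter_ex (filterI (filterI (filterI (filterI (filterI (filterI xg Ures) U3) U4) U5) U6) U7).
move=> {U3 U4 U5 U6 U7}.
pose h := diff_quot (g n).
have hK s : `|h s| <= K by apply: le_trans (diff_quot_lip0 (g n) s) (gK n).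
have hbdd : bdd (fun s => `|h s|) by apply: bdd_norm; exists K.
have gn0 := lip0_base (g n).
have nupat m : bdd (fun k => nu k (fun s => pattern_at o m (fun s => `|h s|) s.1)).
  have [_ []] := posfun_ulim (U := U) nuP nuB.
  by move=> H _; apply: H; apply: pattern_bdd.
have patbdd : bdd (fun m => ulim U (fun k => nu k (fun s => pattern_at o m (fun s => `|h s|) s.1))).
  apply: (@bdd_itv _ _ _ (4 * K * 5 ^+ d * B)) => m.
  have patm k : 0 <= nu k (fun s => pattern_at o m (fun s => `|h s|) s.1) <= 4 * K * 5 ^+ d * B.
    have pb s := pattern_itv o m s (fun u => introT andP (conj (normr_ge0 (h u)) (hK u))).
    have pbdd := pattern_bdd o m hbdd.
    rewrite (nuP k).2 => [||s] /=; [|exact: pbdd|by have /andP[] := pb s.1].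
    apply: le_trans (posfun_le_cst (nuP k) (M := 4 * K * 5 ^+ d) pbdd _) _.
      by move=> s; have /andP[] := pb s.1.
    by rewrite ler_wpM2l// !mulr_ge0// exprn_ge0.
  rewrite ulim_ge => [|//|]; last by apply: nearW => k; have /andP[] := patm k.
  by apply: ulim_le => //; apply: nearW => k; have /andP[] := patm k.
have V1 := ulim_lt (UU := UU) patbdd nusmall.
have V2 := ooU (smoothing_approx K0 gn0 (gKlip n) (rho + 1) (divr_gt0 w0 (ltr0n R 2))).
have /choice[SM SMP] : forall m, exists G : lip0 o,
    (forall p, G p = smoothing o m (g n) p) /\ `|G| <= A.
  move=> m; have [||p q|G GE Gn] := @lip0_of_bound _ _ o (smoothing o m (g n)) A.
  - exact: smoothing_center.
  - exact: ltW.
  - apply: le_trans (smoothing_lip K0 gn0 (gKlip n) m p q) _.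
    by rewrite ler_wpM2r ?mdist_ge0// lerDl.
  - by exists G.
have V3 : U [set m | forall j, j \in n :: ns ->
    `|lipfree_val (x j) (mul (SM m)) - lipfree_val (x j) (mul (g n))| <= e / 2].
  apply: near_all_seq => j; apply: ooU.
  have smcv : (fun m => lipfree_val (x j) (mul (SM m))) @ \oo --> lipfree_val (x j) (mul (g n)).
    apply: (@lipfree_cvg_pointwise _ _ _ _ _ _ _ _ _ (C * (A + K))).
    - move=> m; apply: le_trans (mulP _).2 _; rewrite ler_wpM2l//.
      by apply: le_trans (SMP m).2 _; rewrite lerDl.
    - apply: le_trans (mulP _).2 _; rewrite ler_wpM2l//.
      by apply: le_trans (gK n) _; rewrite lerDr ltW.
    - move=> p; under eq_fun do rewrite mulE (SMP _).1.
      rewrite mulE; apply: (@cvgM R); first exact: cvg_cst.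
      exact: (smoothing_cvg K0 gn0 (gKlip n)).
  move/cvgrPdist_le : smcv => /(_ _ e20).
  by apply: filterS => m; rewrite distrC.
have [m [[nupatm approx] xmulSM]] := filter_ex (filterI (filterI V1 V2) V3).
move=> {V1 V2 V3}.
have smE := (SMP m).1.
pose a p := slope_bound o m (g n) p / A.
have a01 p : 0 <= a p <= 1.
  rewrite divr_ge0 ?slope_bound_ge0 ?(ltW A0)//= ler_pdivrMr// mul1r.
  by apply: le_trans (slope_bound_le K0 gn0 (gKlip n) m p) _; rewrite lerDl.
have [La La0 slopeL] := slope_bound_lip K0 gn0 (gKlip n) m.
have [rho' slope_out] := slope_bound_out o m (g n).
pose phi' p := phi p * (1 - a p).
have D0 p q := mdist_ge0 (p : E) q.
exists (S + mul (SM m)), phi', (tol / 2), n; split=> //; split.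
- by apply/andP; split; lra.
- split=> [p||].
  + have /andP[? ?] := phi01 p; have /andP[? ?] := a01 p.
    by rewrite mulr_ge0 ?mulr_ile1 ?subr_ge0//; lra.
  + exists (L + La / A); first by rewrite addr_ge0// divr_ge0// ltW.
    move=> p q; rewrite /phi'; have /andP[p0 p1] := phi01 p; have /andP[aq0 aq1] := a01 q.
    have -> : phi p * (1 - a p) - phi q * (1 - a q) =
      (phi p - phi q) * (1 - a q) - phi p * (a p - a q) by ring.
    rewrite (le_trans (ler_normB _ _))// [leRHS]mulrDl lerD//.
      rewrite normrM (le_trans _ (phiL p q))// ler_piMr// ger0_norm; lra.
    rewrite normrM (ger0_norm p0); apply: (@le_trans _ _ `|a p - a q|); first exact: ler_piMl.
    by rewrite /a -mulrBl normrM (gtr0_norm (_ : 0 < A^-1)) ?invr_gt0// mulrAC ler_pM2r ?invr_gt0.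
  + exists (Num.max rho rho') => p; rewrite ge_max => /andP[h1 h2].
    by rewrite /phi' /a slope_out// phi1// mul0r subr0 mulr1.
(* Here [1 - phi' = (1 - phi) + phi a], and the pattern bound makes the added mass at most
   [tol / 2], exactly what halving the tolerance releases. *)
- have Uk := ulim_lt (UU := UU) (nupat m) nupatm.
  apply: filterS2 Ures Uk => k /= Resk patk.
  have phibdd : bdd (fun s : E * E => 1 - phi s.1).
    by apply: (@bdd_itv _ _ _ 1) => s; have := phi01 s.1; lra.
  have pbdd : bdd (fun s : E * E => pattern_at o m (fun s => `|h s|) s.1) by exact: pattern_bdd.
  have : nu k (fun s => 1 - phi' s.1) <=
      nu k (fun s => 6 * d%:R ^+ 2 * pattern_at o m (fun s => `|h s|) s.1 + (1 - phi s.1)).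
    apply: (le_posfun (nuP k)) => [||s].
    - apply: (@bdd_itv _ _ _ 1) => s; have /andP[? ?] := phi01 s.1; have /andP[? ?] := a01 s.1.
      have : 0 <= phi s.1 * (1 - a s.1) <= 1.
        by rewrite mulr_ge0 ?mulr_ile1 ?subr_ge0//; lra.
      by rewrite /phi'; lra.
    - by apply: bddD => //; apply: bddM => //; exact: bdd_cst.
    - have /andP[p0 p1] := phi01 s.1; have /andP[a0 a1] := a01 s.1.
      have pa : phi s.1 * a s.1 <= a s.1 by exact: ler_piMl.
      have aS : a s.1 <= slope_bound o m (g n) s.1.
        by rewrite ler_pdivrMr// ler_peMr// slope_bound_ge0.
      have := slope_bound_le_pattern m s.1 gn0.
      by rewrite /phi' mulrBr mulr1 -/h; lra.
  rewrite (nuP k).1// => h1.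
  have : 6 * d%:R ^+ 2 * nu k (fun s => pattern_at o m (fun s => `|h s|) s.1) <= tol / 2.
    by apply: le_trans e3d; rewrite ler_wpM2l// ltW.
  by move: Resk h1; rewrite -/h; lra.
- exists (Num.min r (Num.min 1 (mesh m))).
    by rewrite !lt_min r0 ltr01 mesh_gt0.
  move=> p q; rewrite !lt_min => /and3P[pqr pq1 pqm].
  rewrite -[(S + _) p]/(S p + mul (SM m) p) -[(S + _) q]/(S q + mul (SM m) q).
  have -> : S p + mul (SM m) p - (S q + mul (SM m) q) =
    (S p - S q) + (mul (SM m) p - mul (SM m) q) by ring.
  rewrite (le_trans (ler_normD _ _))//.
  have h1 := Sslope _ _ pqr.
  have smw u : mdist u o <= rho + 1 -> `|smoothing o m (g n) u| <= w.
    move=> uo; have := approx _ uo; have := gsmall _ uo.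
    have := ler_normD (smoothing o m (g n) u - g n u) (g n u).
    by rewrite subrK; lra.
  have h2 := mul_local_lip L0 phi01 phiL phi1 (ltW w0) smw (ltW pq1).
  rewrite -!smE -!mulE in h2.
  have h3 : phi p * `|SM m p - SM m q| <= phi p * a p * A * mdist p q.
    have -> : phi p * a p * A * mdist p q = phi p * (slope_bound o m (g n) p * mdist p q).
      by rewrite /a; field; rewrite gt_eqF.
    have /andP[p0 _] := phi01 p; rewrite ler_wpM2l// !smE.
    exact: smoothing_local_lip (ltW pqm).
  have h4 : L * w * mdist p q <= e / 2 * mdist p q by rewrite ler_wpM2r.
  (* The telescoping: replacing [phi] by [phi'] raises the allowance by [phi a A], the local slope
     of the new term, and the halved tolerance leaves [tol / 2] for the Leibniz error. *)
  have h5 : (A * (1 - phi' p) + 1 - tol / 2) * mdist p q =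
    (A * (1 - phi p) + 1 - tol) * mdist p q + phi p * a p * A * mdist p q + tol / 2 * mdist p q.
    by rewrite /phi'; field.
  rewrite h5; have : e / 2 * mdist p q <= tol / 2 * mdist p q.
    by rewrite ler_wpM2r//; lra.
  by lra.
- move=> j; rewrite in_cons => /predU1P[->|jns]; last first.
    rewrite linearD; have := xmul j jns; have := xmulSM j; rewrite in_cons jns orbT => /(_ isT).
    rewrite !ler_norml => /andP[? ?] /andP[? ?].
    by have := Sns j jns; lra.
  rewrite linearD; have := xmulSM n; rewrite in_cons eqxx => /(_ isT).
  (* [x n] hardly notices the cutoff: the difference quotients of [(1 - phi) g_n] are at most
     [K * (1 - phi) + L * w], and [nu n] gives little mass to [1 - phi] by the invariant of the
     stage. *)
  have gmul : lipfree_val (x n) (g n) - lipfree_val (x n) (mul (g n)) <= delta0 / 8 + e / 2.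
    have -> : lipfree_val (x n) (g n) - lipfree_val (x n) (mul (g n)) =
      lipfree_val (x n) (g n - mul (g n)) by rewrite linearB.
    rewrite nuE.
    have qb s : `|diff_quot (g n - mul (g n)) s| <= K * (1 - phi s.1) + L * w.
      have /andP[? ?] := phi01 s.1; apply: diff_quot_le.
        by rewrite addr_ge0// mulr_ge0// subr_ge0.
      have gmE u : (g n - mul (g n)) u = (1 - phi u) * g n u.
        by rewrite -[LHS]/(g n u - mul (g n) u) mulE mulrBl mul1r.
      rewrite !gmE; apply: (@compl_mul_lip R d o phi L rho L0 phi01 phiL phi1
        (g n : E -> R) K w s.1 s.2 (ltW w0) (gKlip n)).
      move=> u uo; apply: (le_trans (gsmall u _)); first by lra.
      by lra.
    have phibdd : bdd (fun s : E * E => 1 - phi s.1).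
      by apply: (@bdd_itv _ _ _ 1) => s; have := phi01 s.1; lra.
    have : nu n (diff_quot (g n - mul (g n))) <= nu n (fun s => K * (1 - phi s.1) + L * w).
      apply: (le_posfun (nuP n)); first exact: bdd_diff_quot_lip0.
        by apply: bddD; [apply: bddM => //; exact: bdd_cst|exact: bdd_cst].
      by move=> s; exact: le_trans (ler_norm _) (qb s).
    rewrite (nuP n).1//; last exact: bdd_cst.
    rewrite (posfun_cst (nuP n) (L * w)) => h1.
    have h2 : L * w * nu n (fun=> 1) <= e / 2.
      by apply: le_trans LwB; rewrite ler_wpM2l.
    have h3 : K * nu n (fun s => 1 - phi s.1) <= delta0 / 8.
      apply: (@le_trans _ _ (K * (delta0 / (8 * (K + 1))))).
        by rewrite ler_wpM2l//; move: Resn => /=; lra.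
      have -> : K * (delta0 / (8 * (K + 1))) = delta0 / 8 * (K / (K + 1)).
        by field; rewrite gt_eqF// ltr_wpDl.
      by rewrite ler_piMr ?divr_ge0 ?(ltW delta_gt0)// ler_pdivrMr ?ltr_wpDl// mul1r lerDl.
    by lra.
  rewrite !ler_norml => /andP[? ?]; move: xgn xS => /= xgn.
  rewrite ler_norml => /andP[? ?]; lra.
Qed.

End Construction.

(** * The limit functional and the conclusion *)

Section DunfordPettis.
Context {R : realType} {d : nat} {o : euclidean R d}.
Local Notation E := (euclidean R d).

Lemma stage_norm_le (x : nat -> lipfree o) nu U (K B delta0 : R) S phi tol ns :
  @stage R d o x nu U K delta0 S phi tol ns -> 0 <= K -> `|S| <= slope_scale (d := d) K + 1.
Proof.
move=> [/andP[tol0 _] [phi01 _ _] _ [r r0 Sr] _] K0.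
have A0 : 0 <= slope_scale (d := d) K.
  by rewrite addr_ge0// !mulr_ge0// exprn_ge0.
apply: lip_norm_le; first by rewrite addr_ge0.
apply: (lipschitz_local_global r0) => p q /Sr /le_trans; apply.
have /andP[p0 p1] := phi01 p.
by rewrite ler_wpM2r ?mdist_ge0//; have := mulr_ge0 A0 p0; lra.
Qed.

Lemma no_positive_pairing (x : nat -> lipfree o) (f : nat -> dual (lipfree o))
    (U : set_system nat) {UU : UltraFilter U} (delta0 : R) :
  weakly_null x -> weakly_null f -> \oo `<=` U -> 0 < delta0 ->
  ~ U [set n | delta0 <= f n (x n)].
Proof.
move=> wx wf ooU delta_gt0 Ufx.
have [B B0 xB] := weakly_null_lipfree_bounded wx.
have [K K0 fK] := weakly_null_dual_bounded wf.
have /choice[g gP] : forall n, exists G : lip0 o, [/\ forall p, G p = f n (free_delta o p),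
    `|G| <= `|f n| & forall y, f n y = lipfree_val y G].
  by move=> n; exact: lip_of_dual.
have gf n p : g n p = f n (free_delta o p) by have [->] := gP n.
have gn n : `|g n| <= `|f n| by have [] := gP n.
have fg n y : f n y = lipfree_val y (g n) by have [] := gP n.
have gK n : `|g n| <= K by exact: le_trans (gn n) (fK n).
have g0 p : (fun n => g n p) @ \oo --> (0 : R^o).
  by under eq_fun do rewrite gf; exact: weakly_null_eval.
have x0 h := weakly_null_lipfree h wx.
have /choice[nu nuP'] : forall n, exists nu : (E * E -> R) -> R,
    [/\ posfun nu, nu (fun=> 1) <= B & forall h : lip0 o, lipfree_val (x n) h = nu (diff_quot h)].
  move=> n; have [nu [nuP nu1 nuE]] := dual_lip0_posfun (lipfree_val (x n)).
  by exists nu; split=> //; apply: le_trans nu1 _; rewrite -lipfree_normE.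
have nuP n : posfun (nu n) by have [] := nuP' n.
have nuB n : nu n (fun=> 1) <= B by have [] := nuP' n.
have nuE n h : lipfree_val (x n) h = nu n (diff_quot h) by have [] := nuP' n.
(* The limit in [k] for fixed [m], then in [m], of [nu k] composed with [pattern_at o m]: a positive
   functional independent of [f], to which [weakly_null_posfun] applies. *)
have patP m := posfun_ulim (UU := UU) (fun n => (posfun_pattern o m (nuP n)).1)
  (fun n => le_trans (posfun_pattern o m (nuP n)).2
    (ler_wpM2l (mulr_ge0 (ler0n R 4) (exprn_ge0 d (ler0n R 5))) (nuB n))).
have [limP _] := posfun_ulim (UU := UU) (fun m => (patP m).1) (fun m => (patP m).2.2).
have g_nu0 := weakly_null_posfun limP wf gf gn.
have xg : U [set n | delta0 <= lipfree_val (x n) (g n)].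
  by apply: filterS Ufx => n /=; rewrite fg.
pose st S phi tol ns := @stage R d o x nu U K delta0 S phi tol ns.
pose state := {q : lip0 o * (E -> R) * R * seq nat | st q.1.1.1 q.1.1.2 q.1.2 q.2}.
pose idx (s : state) := (sval s).2.
have next_ex (s : state) : {s' : state |
    exists n, (head 0 (idx s) < n)%N /\ idx s' = n :: idx s}.
  apply: cid; case: s => [[[[S phi] tol] ns] /= stP].
  have [S' [phi' [tol' [n [nn stP']]]]] :=
    stage_step ooU B0 delta_gt0 gK g0 x0 nuP nuB nuE g_nu0 xg (head 0%N ns) stP.
  by exists (exist _ (S', phi', tol', n :: ns) stP'); exists n.
(* Conditions for starting with [S = 0] and [phi = 1]: the slope allowance [1 - tol] must be
   nonnegative, and the mass condition reduces to a bound on [tol]. *)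
have [tol [tol0 tol1 told tolr]] : exists tol : R,
    [/\ 0 < tol, tol <= 1, tol <= delta0 / 2 & tol <= delta0 / (8 * (K + 1))].
  exists (Num.min 1 (Num.min (delta0 / 2) (delta0 / (8 * (K + 1))))).
  rewrite !lt_min ltr01 !divr_gt0//; last by rewrite mulr_gt0// ltr_wpDl.
  by split=> //; rewrite !ge_min lexx ?orbT.
have st0 : st 0 (fun=> 1) tol [::].
  split=> //; first by rewrite tol0 told.
  - split=> [p||]; first by rewrite ler01 lexx.
      by exists 0 => // p q; rewrite subrr normr0 mul0r.
    by exists 0.
  - apply: nearW => n /=; under [X in nu n X]eq_fun do rewrite subrr.
    by rewrite posfun0// add0r.
  - exists 1 => // p q _; rewrite subrr normr0 subrr mulr0 add0r.
    by rewrite mulr_ge0 ?mdist_ge0// subr_ge0.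
have [s [_ sn]] := dependent_choice next_ex (exist _ (0, fun=> 1, tol, [::]) st0).
pose S k := (sval (s k)).1.1.1.
have idx_head k : (k <= head 0 (idx (s k)))%N.
  elim: k => [//|k IH]; have [n [kn ->]] := sn k.
  exact: leq_ltn_trans IH kn.
have idx_mem k l : (k < l)%N -> head 0%N (idx (s k.+1)) \in idx (s l).
  elim: l => [//|l IH]; rewrite ltnS leq_eqVlt => /predU1P[->|/IH kl].
    by have [n [_ ->]] := sn l; rewrite mem_head.
  by have [n [_ ->]] := sn l; rewrite in_cons kl orbT.
have Sn k : `|S k| <= slope_scale (d := d) K + 1.
  exact: stage_norm_le (proj2_sig (s k)) K0.
have c0 : 0 <= slope_scale (d := d) K + 1.
  by apply: le_trans (Sn 0%N).
have Sb (y : lipfree o) k : `|lipfree_val y (S k)| <= (slope_scale (d := d) K + 1) * `|y|.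
  rewrite mulrC lipfree_normE; apply: le_trans (dual_norm_bound _ _) _.
  by rewrite ler_wpM2l ?dual_norm_ge0.
have Sbdd (y : lipfree o) : bdd (fun k => lipfree_val y (S k)).
  by exists ((slope_scale (d := d) K + 1) * `|y|) => k; exact: Sb.
(* [F] is a weak-star limit of the partial sums, which are bounded in Lip_0. Each selected index
   belongs to all later stages, so [F] is at least [delta0 / 2] at infinitely many [x n]. *)
have [|y|F FE _] := @dual_of_bound _ _
  (fun y : lipfree o => ulim U (fun k => lipfree_val y (S k))) _ c0.
- move=> a y z; rewrite -[RHS]/(a * ulim U _ + ulim U _).
  by rewrite -(ulim_posfun (U := U)).1.
- apply: le_trans (posfun_norm_le (ulim_posfun (UU := UU)) (Sb y)) _.
  by rewrite ulim1 mulr1.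
have d20 : 0 < delta0 / 2 by rewrite divr_gt0.
have /cvgrPdist_lt/(_ _ d20)[N _ FN] : (fun n => F (x n)) @ \oo --> (0 : R^o).
  by move/weakly_nullP : wx; exact.
pose n := head 0%N (idx (s N.+1)).
have := FN n (ltnW (idx_head N.+1)); rewrite /= sub0r normrN ltNge => /negP; apply.
rewrite FE; apply: le_trans (ler_norm _); apply: ulim_ge => //.
apply: filterS (ooU _ (nbhs_infty_gt N)) => l /= Nl.
have [/andP[t0 _] _ _ _ Snl] := proj2_sig (s l).
by have := Snl _ (idx_mem _ _ Nl); rewrite -/(S l) -/n; lra.
Qed.

End DunfordPettis.

Theorem theorem1 (R : realType) (d : nat) (o : euclidean R d) :
  dunford_pettis (lipfree o).
Proof.
move=> x f wx wf; apply: contrapT => ncv.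
have [e e0 infe] : exists2 e : R, 0 < e & forall N, exists2 n, (N <= n)%N &
    e <= `|f n (x n)|.
  apply: contrapT => nE; apply: ncv; apply/cvgrPdist_lt => e e0.
  apply: contrapT => nN; apply: nE; exists e => // N.
  apply: contrapT => nn; apply: nN; exists N => // n /= Nn.
  rewrite sub0r normrN ltNge; apply/negP => en.
  by apply: nn; exists n.
have [U [UU ooU Ue]] := ultra_frequently infe.
(* The ultrafilter decides the sign of the pairing; the negative case passes to the weakly null
   sequence [- f n]. *)
have [Up|Un] := in_ultra_setVsetC [set n | e <= f n (x n)] UU.
  exact: (no_positive_pairing wx wf ooU e0 Up).
have wNf : weakly_null (fun n => - f n).
  apply/weakly_nullP => F; move/weakly_nullP : wf => /(_ F)/cvgN.
  by rewrite oppr0; under [X in _ -> X @ _ --> _]eq_fun do rewrite linearN.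
apply: (no_positive_pairing wx wNf ooU e0).
apply: filterS (filterI Ue Un) => n /= [en nn].
suff : e <= - f n (x n) by [].
by move: en; rewrite ler_normr => /orP[/nn//|].
Qed.
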